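(* Let $X$ be a complex manifold, $E$ a holomorphic vector bundle over $X$ and $k$ a positive integer. For an open cover $\mathcal U=\{U_i\}_{i\in I}$ of $X$ ($I$ an ordered set) with respect to which $E$ has a trivialization, let $f_{k,\mathcal U}(E)\in\check H^k(\mathcal U,\Omega^k)$ be the class of the Čech $k$-cocycle $(t_{i_1\cdots i_{k+1}})_{i_1<\cdots<i_{k+1}}$, $$t_{i_1\cdots i_{k+1}}:=\sum_{\sigma\in S_{k+1}}\frac{\mathrm{sgn}(\sigma)}{(k+1)!}\,\mathrm{tr}\Big(\prod_{l=1}^{k} g^{-1}_{i_{\sigma(l)}i_{\sigma(k+1)}}dg_{i_{\sigma(l)}i_{\sigma(k+1)}}\Big)$$ (factors ordered $l=1,2,\dots,k$ from left to right), where $g=\{g_{ij}\}$ is any system of transition functions of $E$ with respect to $\mathcal U$ (this class does not depend on the choice of $g$). Denote by $f_k(E)$ the image of $f_{k,\mathcal U}(E)$ in $\check H^k(X,\Omega^k)$ under the canonical homomorphism $\check H^k(\mathcal U,\Omega^k)\to\check H^k(X,\Omega^k)$. Then $f_k(E)$ is independent of the choice of $\mathcal U$.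
   Context: $\Omega^k$ is the sheaf of germs of holomorphic differential $k$-forms on $X$. A trivialization of $E$ (of rank $M$) with respect to $\mathcal U$ is a family of holomorphic bundle isomorphisms $\phi_i:E|_{U_i}\to U_i\times\mathbb C^M$; its system of transition functions consists of the holomorphic maps $g_{ij}:U_i\cap U_j\to GL(M,\mathbb C)$ with $\phi_i\circ\phi_j^{-1}(z,v)=(z,g_{ij}(z)v)$. Write $U_{i_1\cdots i_p}=U_{i_1}\cap\cdots\cap U_{i_p}$. $dg_{ij}$ is the entrywise differential; products are matrix products in which entries are multiplied by the wedge product. For a sheaf $\mathcal S$, Čech $k$-cochains with respect to $\mathcal U$ are families $(s_{i_1\cdots i_{k+1}})_{i_1<\cdots<i_{k+1}}$, $s_{i_1\cdots i_{k+1}}\in\Gamma(U_{i_1\cdots i_{k+1}},\mathcal S)$ (extended alternatingly to all index tuples), with differential $(\partial s)_{i_1\cdots i_{k+2}}=\sum_{j}(-1)^{j+1}s_{i_1\cdots\widehat{i_j}\cdots i_{k+2}}$; $\check H^k(\mathcal U,\mathcal S)$ is the resulting cohomology, and $\check H^k(X,\mathcal S)=\varinjlim_{\mathcal U}\check H^k(\mathcal U,\mathcal S)$ is the direct limit over open covers under refinement. The class $f_k(E)$ is called the $k$-th $T$ invariant of $E$. *)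

(* Defs.v *)
From HB Require Import structures.
From mathcomp Require Import all_boot all_order all_algebra perm.
From mathcomp Require Import all_classical all_reals all_analysis.
From Stdlib Require Import Relations.

Set Implicit Arguments.
Unset Strict Implicit.
Unset Printing Implicit Defensive.

Import Order.TTheory GRing.Theory Num.Theory numFieldNormedType.Exports.

Local Open Scope classical_set_scope.
Local Open Scope ring_scope.

(* The base field C is kept abstract to have the topology and the norm of C and
   of the spaces 'rV[C]_n inferred; complex geometry is the case C = R[i] with
   R : realType. *)

Section Holomorphic.
Variables (C : numFieldType) (V W : normedModType C).

(* [differentiable] is Frechet differentiability over the base field,
   i.e., complex differentiability when C = R[i]. *)
Fixpoint class_C (m : nat) (U : set V) (f : V -> W) : Prop :=
  match m with
  | 0 => forall x, U x -> {for x, continuous f}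
  | m'.+1 => (forall x, U x -> differentiable f x) /\
             (forall v, class_C m' U ('D_v f))
  end.

(* The convention (e.g. of Griffiths and Harris) that a holomorphic map is a
   C^oo map whose differential is complex linear at every point. *)
Definition holomorphic (U : set V) (f : V -> W) : Prop :=
  forall m, class_C m U f.

End Holomorphic.

(* [cmap c] and [cinv c] are total functions, meaningful only on [cdom c] and
   on its image [cmap c @` cdom c] respectively. *)
Record complexManifold (C : numFieldType) (n : nat) := ComplexManifold {
  mfd :> topologicalType;
  mfd_hausdorff : hausdorff_space mfd;
  mfd_second_countable : @second_countable mfd;
  chart : Type;
  cdom : chart -> set mfd;
  cmap : chart -> mfd -> 'rV[C]_n;
  cinv : chart -> 'rV[C]_n -> mfd;
  cdom_open : forall c, open (cdom c);
  cimg_open : forall c, open (cmap c @` cdom c);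
  cmapK : forall c x, cdom c x -> cinv c (cmap c x) = x;
  cmap_continuous : forall c x, cdom c x -> {for x, continuous (cmap c)};
  cinv_continuous :
    forall c z, (cmap c @` cdom c) z -> {for z, continuous (cinv c)};
  cdom_cover : forall x, exists c, cdom c x;
  chart_compat : forall c c',
    holomorphic (cmap c @` (cdom c `&` cdom c')) (cmap c' \o cinv c)
}.

(* Restriction of a function to W, extended by zero so that restricted
   functions on W are equal iff they agree on W. *)
Definition restr (T : Type) (V : zmodType) (W : set T) (f : T -> V) : T -> V :=
  patch (fun=> 0) W f.

Section Forms.
Variables (C : numFieldType) (n : nat) (X : complexManifold C n).

Definition holo_fun (W : set X) (f : X -> C) : Prop :=
  forall c : chart X,
    @holomorphic C 'rV[C]_n C (cmap c @` (W `&` cdom c)) (f \o cinv c).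

Definition holo_mx (M : nat) (W : set X) (g : X -> 'M[C]_M) : Prop :=
  forall a b, holo_fun W (fun x => g x a b).

(* Value of a k-form at a point, read in every chart: a function of k tangent
   vectors, given in the coordinates of the chart as the rows of a matrix. *)
Definition kcovector (k : nat) : Type := chart X -> 'M[C]_(k, n) -> C.

HB.instance Definition _ k :=
  GRing.Zmodule.copy (kcovector k) (chart X -> 'M[C]_(k, n) -> C).

Definition form_field (k : nat) : Type := X -> kcovector k.

HB.instance Definition _ k :=
  GRing.Zmodule.copy (form_field k) (X -> kcovector k).

Definition multilinear k (a : 'M[C]_(k, n) -> C) : Prop :=
  forall (A B D : 'M[C]_(k, n)) (i0 : 'I_k) (b c : C),
    row i0 A = b *: row i0 B + c *: row i0 D ->
    row' i0 B = row' i0 A -> row' i0 D = row' i0 A ->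
    a A = b * a B + c * a D.

Definition alternate k (a : 'M[C]_(k, n) -> C) : Prop :=
  forall (A : 'M[C]_(k, n)) (i1 i2 : 'I_k),
    i1 != i2 -> row i1 A = row i2 A -> a A = 0.

(* Jacobian at x of the change of coordinates from the chart c to c'; it acts
   on the right on coordinate row vectors. *)
Definition coord_jacobian (c c' : chart X) (x : X) : 'M[C]_n :=
  jacobian (cmap c' \o cinv c) (cmap c x).

(* Sections over the open set W; by convention they vanish where they are not
   meaningful, so that equality of sections is equality of functions. *)
Definition Omega (k : nat) (W : set X) : set (form_field k) :=
  [set w | [/\ forall x c, ~ (W x /\ cdom c x) -> w x c = 0,
     forall x c, W x -> cdom c x -> multilinear (w x c) /\ alternate (w x c),
     forall x c c' A, W x -> cdom c x -> cdom c' x ->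
       w x c A = w x c' (A *m coord_jacobian c c' x) &
     forall c A, @holomorphic C 'rV[C]_n C
       (cmap c @` (W `&` cdom c)) (fun z => w (cinv c z) c A)]].

Definition wedge p q (a : form_field p) (b : form_field q) :
    form_field (p + q) :=
  fun x c A => (p`! * q`!)%:R^-1 *
    \sum_(s : 'S_(p + q)) (-1) ^+ s *
      (a x c (usubmx (row_perm s A)) * b x c (dsubmx (row_perm s A))).

Definition dform (f : X -> C) : form_field 1 :=
  fun x c v => if x \in cdom c then
    'd (f \o cinv c : 'rV[C]_n -> C) (cmap c x) v else 0.

Section MatrixForms.
Variable M : nat.

Definition wedge_mx p q (A : 'M[form_field p]_M) (B : 'M[form_field q]_M) :
    'M[form_field (p + q)]_M :=
  \matrix_(a, b) \sum_l wedge (A a l) (B l b).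

Definition one_mx : 'M[form_field 0]_M :=
  \matrix_(a, b) (fun _ _ _ => (a == b)%:R).

Fixpoint wedge_prod (k : nat) : ('I_k -> 'M[form_field 1]_M) ->
    'M[form_field k]_M :=
  match k return ('I_k -> 'M[form_field 1]_M) -> 'M[form_field k]_M with
  | 0 => fun _ => one_mx
  | k'.+1 => fun A =>
      wedge_mx (A ord0) (wedge_prod (fun l : 'I_k' => A (lift ord0 l)))
  end.

Definition inv_mul_d (g : X -> 'M[C]_M) : 'M[form_field 1]_M :=
  \matrix_(a, b) (fun x c v =>
    \sum_l invmx (g x) a l * dform (fun y => g y l b) x c v).

(* [lift ord_max] embeds the first k indices into 'I_k.+1. *)
Definition T_form (I : Type) (g : I -> I -> X -> 'M[C]_M) (k : nat)
    (i : 'I_k.+1 -> I) : form_field k :=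
  fun x c A => \sum_(s : 'S_k.+1) (-1) ^+ s / (k.+1)`!%:R *
    (\tr (wedge_prod (fun l : 'I_k =>
       inv_mul_d (g (i (s (lift ord_max l))) (i (s ord_max)))))) x c A.

End MatrixForms.
End Forms.

Record open_cover (T : topologicalType) := OpenCover {
  cover_disp : Order.disp_t;
  cover_idx : orderType cover_disp;
  cover_set :> cover_idx -> set T;
  cover_open : forall i, open (cover_set i);
  cover_full : forall x, exists i, cover_set i x
}.

Section Cech.
(* The sheaf of abelian groups is given by its sections S W over each open W,
   which are functions on T vanishing outside of W. *)
Variables (T : topologicalType) (V : zmodType) (S : set T -> set (T -> V)).

Definition raw_cochain (U : open_cover T) (q : nat) : Type :=
  ('I_q.+1 -> cover_idx U) -> T -> V.

HB.instance Definition _ U q := GRing.Zmodule.copy (raw_cochain U q)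
  (('I_q.+1 -> cover_idx U) -> T -> V).

Definition cap (U : open_cover T) q (i : 'I_q -> cover_idx U) : set T :=
  [set x | forall a, U (i a) x].

Definition increasing (U : open_cover T) q (i : 'I_q -> cover_idx U) : bool :=
  [forall a : 'I_q, forall b : 'I_q, (a < b)%N ==> (i a < i b)%O].

(* Alternating extension of the family of the t i, i increasing: at most one
   permutation s makes i \o s increasing. *)
Definition alt_ext U q (t : raw_cochain U q) : raw_cochain U q :=
  fun i => \sum_(s : 'S_q.+1 | increasing (i \o s)) t (i \o s) *~ (-1) ^+ s.

(* Cochains are represented by their alternating extension. *)
Definition cochain U q (t : raw_cochain U q) : Prop :=
  (forall i, S (cap i) (t i)) /\ alt_ext t = t.

Definition cech_diff U q (t : raw_cochain U q) : raw_cochain U q.+1 :=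
  fun i => restr (cap i) (\sum_(j < q.+2) t (i \o lift j) *~ (-1) ^+ j).

Definition cocycle U q (t : raw_cochain U q) : Prop :=
  cochain t /\ cech_diff t = 0.

Definition coboundary U q : raw_cochain U q -> Prop :=
  match q return raw_cochain U q -> Prop with
  | 0 => fun t => t = 0
  | q'.+1 => fun t => exists2 b : raw_cochain U q', cochain b & t = cech_diff b
  end.

Definition coset U q (t : raw_cochain U q) : set (raw_cochain U q) :=
  [set t' | cocycle t' /\ coboundary (t' - t)].

Definition cechH (U : open_cover T) (q : nat) : Type :=
  {A : set (raw_cochain U q) | exists2 t, cocycle t & A = coset t}.

Definition cech_class U q (t : raw_cochain U q) (ht : cocycle t) : cechH U q :=
  exist _ (coset t) (ex_intro2 _ _ t ht erefl).

Definition refinement (U W : open_cover T) (r : cover_idx W -> cover_idx U) :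
    Prop :=
  forall j, W j `<=` U (r j).

Definition refine U W (r : cover_idx W -> cover_idx U) q
    (t : raw_cochain U q) : raw_cochain W q :=
  fun j => restr (cap j) (t (r \o j)).

(* [refine_to a b]: b is the image of a under a refinement map. *)
Definition refine_to q (a b : {U : open_cover T & cechH U q}) : Prop :=
  exists (r : cover_idx (tag b) -> cover_idx (tag a))
         (t : raw_cochain (tag a) q),
    [/\ refinement r, cocycle t, sval (tagged a) = coset t &
        sval (tagged b) = coset (refine r t)].

(* The direct limit: the quotient of the disjoint union of the cohomology
   groups by the equivalence relation generated by the refinement maps. *)
Definition cech_lim (q : nat) : Type :=
  {C : {U : open_cover T & cechH U q} -> Prop |
    exists a, C = clos_refl_sym_trans _ (@refine_to q) a}.

Definition to_lim q (U : open_cover T) (a : cechH U q) : cech_lim q :=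
  exist _ (clos_refl_sym_trans _ (@refine_to q) (existT _ U a))
    (ex_intro _ (existT _ U a) erefl).

End Cech.

Section FrameDefs.
Variables (C : numFieldType) (n : nat) (X : complexManifold C n) (M : nat).
Variable F : X -> lmodType C.

Definition frame : Type := forall x, F x -> 'cV[C]_M.

Definition is_frame (W : set X) (phi : frame) : Prop :=
  forall x, W x -> linear (phi x) /\ bijective (phi x).

(* phi \o psi^-1 (x, v) = (x, g x *m v) for x in W *)
Definition is_transition (W : set X) (phi psi : frame)
    (g : X -> 'M[C]_M) : Prop :=
  forall x, W x -> forall e : F x, phi x e = g x *m psi x e.

(* phi \o psi^-1 and its inverse are holomorphic over W. *)
Definition frame_compat (W : set X) (phi psi : frame) : Prop :=
  exists g h, [/\ holo_mx W g, holo_mx W h,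
    is_transition W phi psi g & is_transition W psi phi h].

End FrameDefs.

(* The total space is the disjoint union of the fibres; its topology and
   complex structure are those for which the local frames are biholomorphic. *)
Record holVectorBundle (C : numFieldType) (n : nat) (X : complexManifold C n)
    (M : nat) := HolVectorBundle {
  fibre : X -> lmodType C;
  bidx : Type;
  bdom : bidx -> set X;
  bframe : bidx -> frame M fibre;
  bdom_open : forall a, open (bdom a);
  bdom_cover : forall x, exists a, bdom a x;
  bframeP : forall a, is_frame (bdom a) (bframe a);
  bframe_compat : forall a b,
    frame_compat (bdom a `&` bdom b) (bframe a) (bframe b)
}.

Section Trivialization.
Variables (C : numFieldType) (n : nat) (X : complexManifold C n) (M : nat).
Variables (E : holVectorBundle X M) (U : open_cover X).

Record trivialization := Trivialization {
  tframe :> cover_idx U -> frame M (fibre E);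
  tframeP : forall i, is_frame (U i) (tframe i);
  tframe_holo : forall i a,
    frame_compat (U i `&` bdom a) (tframe i) (bframe a)
}.

Definition transition_system (phi : trivialization)
    (g : cover_idx U -> cover_idx U -> X -> 'M[C]_M) : Prop :=
  forall i j, is_transition (U i `&` U j) (phi i) (phi j) (g i j).

End Trivialization.

Section TCocycle.
Variables (C : numFieldType) (n : nat) (X : complexManifold C n) (M : nat).

Definition T_cocycle (U : open_cover X)
    (g : cover_idx U -> cover_idx U -> X -> 'M[C]_M) (k : nat) :
    raw_cochain (kcovector X k) U k :=
  alt_ext (fun i => restr (cap i) (T_form g i)).

End TCocycle.

Arguments Omega {C n} X k W.
Arguments T_cocycle {C n X M U} g k.

(* Main.v *)
Require Import Defs.
From mathcomp Require Import all_boot all_order all_algebra perm.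
From mathcomp Require Import all_classical all_reals all_analysis.
From mathcomp Require Import complex.
From mathcomp Require Import zify.
From Stdlib Require Import Relations.

Set Implicit Arguments.
Unset Strict Implicit.
Unset Printing Implicit Defensive.

Import Order.TTheory GRing.Theory Num.Theory numFieldNormedType.Exports.

Local Open Scope classical_set_scope.
Local Open Scope ring_scope.

(** Why the class is independent of the cover.

    Near a point, compare all the frames with one of them, [o], and put
    [th a = g_ao^-1 dg_ao]. Differentiating [g_ab g_bo = g_ao] gives
    [g_ab^-1 dg_ab = g_bo (th a - th b) g_bo^-1], so that the products under
    the trace in [t] are products of differences, up to a conjugation that the
    trace ignores ([T_form_base]). Antisymmetrizing such a product over all
    the indices gives, up to a factor, [sum_s sgn(s) tr (th (s 1) ... th (s k))]
    ([signed_trace_differences]), because this sum does not change when fixed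
    forms are subtracted from the factors: a signed sum of products in which
    two of the permuted indices do not occur is killed by their transposition.
    Thus, for a fixed frame [o], [t] is an alternating sum over the omitted
    index. In its Cech coboundary two of the [k + 2] indices are absent from
    every product, and the same transposition argument gives 0
    ([signed_trace_cocycle], [T_form_cocycle]). That [t] has values in the
    holomorphic forms is the chain rule together with [g_ab^-1 = g_ba], which
    makes the coefficients polynomials in holomorphic functions and their
    derivatives ([T_form_Omega]).

    Given two trivializations over the same cover, put both frames on each
    open set. The cocycle identity holds for the doubled system of frames, and
    pulling it back along the two ways of choosing one frame on each set gives
    the two T cocycles. These two index maps are joined by a simplicial
    homotopy, whose prism operator produces a cochain bounding the difference
    of the cocycles ([prism_boundary], [T_cocycle_homotopic]). The class over a
    given cover is therefore independent of the trivialization and of [g].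

    Given two covers, both trivializations restrict to the cover by the
    pairwise intersections. Restriction commutes with the formation of the T
    cocycle ([refine_T_cocycle]), and over the common refinement the two
    classes agree by the previous case, hence they agree in the direct limit
    ([T_lim_unique]). *)

(** * Signed sums of traces of products of matrices *)

Section PermUnlift.
Variable n : nat.

Lemma perm_unlift_subproof (i : 'I_n.+1) (s : 'S_n.+1) :
  injective (fun k => odflt k (unlift (s i) (s (lift i k)))).
Proof.
move=> k1 k2 eqk; apply/(@lift_inj _ i)/(@perm_inj _ s).
have liftE k : lift (s i) (odflt k (unlift (s i) (s (lift i k)))) = s (lift i k).
  have := neq_lift i k.
  by rewrite -(inj_eq (@perm_inj _ s)) => /unlift_some[] ? ? ->.
by rewrite -(liftE k1) eqk liftE.
Qed.

(** The permutation of the other indices left when [i] and [s i] are deleted: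
    the cofactor index of [s]. *)
Definition perm_unlift i s : 'S_n := perm (@perm_unlift_subproof i s).

Lemma lift_perm_unlift i (s : 'S_n.+1) : lift_perm i (s i) (perm_unlift i s) = s.
Proof.
apply/permP=> k; case: (unliftP i k) => [k'|] ->; rewrite ?lift_perm_id //.
rewrite lift_perm_lift permE; have := neq_lift i k'.
by rewrite -(inj_eq (@perm_inj _ s)) => /unlift_some[] ? ? ->.
Qed.

Lemma perm_unliftK i j (s : 'S_n) : perm_unlift i (lift_perm i j s) = s.
Proof. by apply/permP=> k; rewrite permE lift_perm_lift lift_perm_id liftK. Qed.

End PermUnlift.

Section SignedSums.
Variables (C : numFieldType) (M : nat).

(** Composition with the transposition of [a] and [b] preserves [f] and
    reverses the signs. *)
Lemma signed_sum_eq0 n (f : 'S_n -> C) (a b : 'I_n) :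
  a != b -> (forall s, f (tperm a b * s)%g = f s) ->
  \sum_(s : 'S_n) (-1) ^+ s * f s = 0.
Proof.
move=> neq_ab fsym; set S := (X in X = 0).
suff : S = - S by move/eqP; rewrite -addr_eq0 -mulr2n mulrn_eq0 => /eqP.
rewrite {1}/S (reindex_inj (mulgI (tperm a b))) -sumrN; apply: eq_bigr => s _ /=.
by rewrite fsym odd_permM odd_tperm neq_ab -mulNr; case: (odd_perm s);
   rewrite !(expr0, expr1, opprK).
Qed.

Lemma prod_slot k (m : 'I_k) (x y z : 'I_k -> 'M[C]_M) (b c : C) :
  x m = b *: y m + c *: z m ->
  (forall l, l != m -> y l = x l) -> (forall l, l != m -> z l = x l) ->
  \prod_l x l = b *: \prod_l y l + c *: \prod_l z l.
Proof.
elim: k m x y z => [|k IH] m x y z xm yx zx; first by case: m xm yx zx => [].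
rewrite !big_ord_recl -!mulmxE; case: (unliftP ord0 m) => [m'|] Dm; subst m.
  rewrite yx ?neq_lift // zx ?neq_lift //.
  rewrite (IH m' _ (fun l => y (lift ord0 l)) (fun l => z (lift ord0 l))) //.
  - by rewrite mulmxDr -!scalemxAr.
  - by move=> l lm; apply: yx; rewrite (inj_eq lift_inj).
  - by move=> l lm; apply: zx; rewrite (inj_eq lift_inj).
have -> : \prod_(l < k) y (lift ord0 l) = \prod_(l < k) x (lift ord0 l).
  by apply: eq_bigr => l _; rewrite yx // eq_sym neq_lift.
have -> : \prod_(l < k) z (lift ord0 l) = \prod_(l < k) x (lift ord0 l).
  by apply: eq_bigr => l _; rewrite zx // eq_sym neq_lift.
by rewrite xm mulmxDl -!scalemxAl.
Qed.

Lemma prod_slot0 k (m : 'I_k) (x : 'I_k -> 'M[C]_M) :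
  x m = 0 -> \prod_l x l = 0.
Proof.
by move=> xm; rewrite (@prod_slot _ m x x x 0 0) // ?xm !scale0r addr0.
Qed.

(** The permutations act on [k.+1] rows and the products have only [k] factors:
    the row sent to the last place is left out, as the term of a Cech
    coboundary leaves out one index. *)
Definition signed_trace k (F : 'I_k.+1 -> 'I_k -> 'M[C]_M) : C :=
  \sum_(s : 'S_k.+1) (-1) ^+ s * \tr (\prod_l F (s (lift ord_max l)) l).

(** Exchanging the shifted factors by the unshifted ones one at a time, each
    difference has a factor [y m] that depends on no value of [s]: it is killed
    by the transposition of [m] and the last index, which appears in no
    factor. *)
Lemma signed_trace_translate k (F : 'I_k.+1 -> 'I_k -> 'M[C]_M)
    (y : 'I_k -> 'M[C]_M) :
  signed_trace (fun a l => F a l - y l) = signed_trace F.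
Proof.
pose z m (l : 'I_k) := if (l < m)%N then y l else 0.
have zE m : (m <= k)%N -> signed_trace (fun a l => F a l - z m l) = signed_trace F.
  elim: m => [|m IH] mk.
    by apply: eq_bigr => s _; under eq_bigr do rewrite subr0.
  rewrite -IH ?(ltnW mk) //; apply/eqP; rewrite -subr_eq0; apply/eqP.
  pose m' := Ordinal mk.
  (* [w s] has the unpaired factor [y m] in place of the [m]-th one. *)
  pose w (s : 'S_k.+1) l := if l == m' then y l else
    F (s (lift ord_max l)) l - z m l.
  have zm (l : 'I_k) : l != m' -> (l < m.+1)%N = (l < m)%N.
    by move=> lm; rewrite ltnS [LHS]leq_eqVlt -[(_ == m :> nat)]/(l == m') (negPf lm).
  rewrite /signed_trace -sumrB.
  rewrite -[RHS](@signed_sum_eq0 _ (fun s => - \tr (\prod_l w s l))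
                    (lift ord_max m') ord_max); last 2 first.
  - by rewrite eq_sym neq_lift.
  - move=> s; congr (- \tr _); apply: eq_bigr => l _; rewrite /w.
    case: eqP => // /eqP lm; rewrite permM tpermD ?neq_lift //.
    by rewrite (inj_eq lift_inj) eq_sym.
  apply: eq_bigr => s _; rewrite -mulrBr; congr (_ * _).
  rewrite (@prod_slot _ m' (fun l => F (s (lift ord_max l)) l - z m.+1 l)
             (fun l => F (s (lift ord_max l)) l - z m l)
             (w s) 1 (-1)).
  - by rewrite mxtraceD !mxtraceZ mul1r mulN1r addrAC subrr add0r.
  - by rewrite /w eqxx /z /= ltnSn ltnn !scale1r scaleN1r subr0.
  - by move=> l lm; rewrite /z zm.
  - by move=> l lm; rewrite /w (negPf lm) /z zm.
rewrite -(zE k) //; apply: eq_bigr => s _.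
by under [X in _ = _ * \tr X]eq_bigr do rewrite /z ltn_ord.
Qed.

(** Group the permutations by [r := s ord_max]. In the sum of all the
    products of the differences [F (s l) l - F r l], those with
    [s ord_max != r] have a zero factor, so that each group contributes the
    signed trace of a translate of [F]. *)
Lemma signed_trace_differences k (F : 'I_k.+1 -> 'I_k -> 'M[C]_M) :
  \sum_(s : 'S_k.+1) (-1) ^+ s *
    \tr (\prod_l (F (s (lift ord_max l)) l - F (s ord_max) l)) =
  k.+1%:R * signed_trace F.
Proof.
rewrite (partition_big (fun s : 'S_k.+1 => s ord_max) predT) //=.
transitivity (\sum_(r < k.+1) signed_trace F); last first.
  by rewrite sumr_const card_ord mulr_natl.
apply: eq_bigr => r _; rewrite -(signed_trace_translate F (F r)).
rewrite /signed_trace [RHS](bigID (fun s : 'S_k.+1 => s ord_max == r)) /=.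
rewrite [X in _ = _ + X]big1 ?addr0 => [|s nr].
  by apply: eq_bigr => s /eqP ->.
case: (unliftP ord_max (s^-1 r)%g) => [l|] Dr; last first.
  by move: nr; rewrite -Dr permKV eqxx.
by rewrite (prod_slot0 (m := l)) ?mxtrace0 ?mulr0 // -Dr permKV subrr.
Qed.

Lemma partition_perm_lift n (i : 'I_n.+1) (f : 'S_n.+1 -> C) :
  \sum_s f s = \sum_j \sum_(s : 'S_n) f (lift_perm i j s).
Proof.
rewrite (partition_big (fun s : 'S_n.+1 => s i) predT) //=.
apply: eq_bigr => j _; rewrite (reindex (lift_perm i j)) /=.
  by apply: eq_bigl => s; rewrite lift_perm_id eqxx.
exists (perm_unlift i) => [s _ | s]; first exact: perm_unliftK.
by move/(s _ =P _) => <-; exact: lift_perm_unlift.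
Qed.

(** The alternating sum is a signed sum over ['S_k.+2] of products that involve
    only [k] of the [k.+2] indices, and is killed by the transposition of two
    others. *)
Lemma signed_trace_cocycle k (F : 'I_k.+2 -> 'I_k -> 'M[C]_M) :
  \sum_(j < k.+2) (-1) ^+ j * signed_trace (fun a => F (lift j a)) = 0.
Proof.
pose f (s : 'S_k.+2) :=
  \tr (\prod_l F (s (lift ord_max (lift ord_max l))) l).
have : \sum_(s : 'S_k.+2) (-1) ^+ s * f s = 0.
  apply: (@signed_sum_eq0 _ _ ord_max (lift ord_max ord_max)).
    exact: neq_lift.
  move=> s; congr (\tr _); apply: eq_bigr => l _; rewrite permM tpermD //.
    exact: neq_lift.
  by rewrite (inj_eq lift_inj) neq_lift.
rewrite (@partition_perm_lift _ ord_max) => S0.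
apply: (mulfI (negbT (signr_eq0 C k.+1))); rewrite mulr0 -[RHS]S0 mulr_sumr.
apply: eq_bigr => j _; rewrite mulr_sumr mulr_sumr; apply: eq_bigr => s _.
rewrite !mulrA; congr (_ * _).
  by rewrite odd_lift_perm !signr_addb !signr_odd.
by congr (\tr _); apply: eq_bigr => l _; rewrite lift_perm_lift.
Qed.

End SignedSums.

(** * Values of products of matrices of 1-forms *)

Section Values.
Variables (C : numFieldType) (n : nat) (X : complexManifold C n) (M : nat).

Lemma form_sumE k (I : Type) (r : seq I) (P : pred I) (F : I -> form_field X k)
    x c A : (\sum_(i <- r | P i) F i) x c A = \sum_(i <- r | P i) F i x c A.
Proof. exact: (big_morph (fun w : form_field X k => w x c A)). Qed.

Definition mx_value (W : 'M[form_field X 1]_M) x c (v : 'rV[C]_n) : 'M[C]_M :=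
  \matrix_(a, b) W a b x c v.

(** By induction, a wedge with a 1-form sums over permutations [s] of all the
    arguments and [t] of the last [k] ones. Absorbing [t] into [s] leaves
    [k`!] times the same sum, which the normalisation of the wedge product
    cancels. *)
Lemma wedge_prod_value k (W : 'I_k -> 'M[form_field X 1]_M) x c A a b :
  wedge_prod W a b x c A =
  (\sum_(s : 'S_k) (-1) ^+ s *:
     \prod_l mx_value (W l) x c (row (s l) A)) a b.
Proof.
elim: k W A a b => [|k IH] W A a b.
  rewrite (big_pred1 (1%g : 'S_0)) => [|s]; last by symmetry; apply/eqP/permP=> [[]].
  by rewrite big_ord0 odd_perm1 scale1r !mxE.
pose w i l := mx_value (W l) x c (row i A).
pose p (s : 'S_k.+1) : 'M[C]_M := (-1) ^+ s *: \prod_l w (s l) l.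
have wedgeE l : wedge (W ord0 a l) (wedge_prod (fun j => W (lift ord0 j)) l b) x c A =
    (k`!)%:R^-1 * \sum_(t : 'S_k) \sum_(s : 'S_k.+1) (-1) ^+ s * (-1) ^+ t *
     (w (s ord0) ord0 a l * (\prod_j w (s (lift ord0 (t j))) (lift ord0 j)) l b).
  rewrite /wedge -[1`!]/1%N mul1n; congr (_ * _).
  rewrite exchange_big /=; apply: eq_bigr => s _.
  rewrite IH summxE !mulr_sumr; apply: eq_bigr => t _.
  rewrite mxE -mulrA; congr (_ * _); rewrite mulrCA; congr (_ * (_ * _)).
    rewrite mxE; congr (W _ _ _ _ _ _); apply/matrixP => i j.
    by rewrite !mxE (ord1 i); congr (A (s _) _); apply: val_inj.
  congr (fun_of_matrix _ _ _); apply: eq_bigr => j _; congr mx_value.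
  apply/matrixP => i j'; rewrite !mxE; congr (A (s _) _); exact: val_inj.
transitivity ((\sum_s p s) a b); last by [].
rewrite /= mxE form_sumE (eq_bigr _ (fun l _ => wedgeE l)) -mulr_sumr.
apply: (canLR (mulKf _)); first by rewrite pnatr_eq0 -lt0n fact_gt0.
rewrite exchange_big /=.
rewrite -[in RHS](card_Sn k) mulr_natl -sumr_const; apply: eq_bigr => t _.
rewrite exchange_big /= summxE (reindex_inj (mulgI (lift_perm ord0 ord0 t^-1))) /=.
apply: eq_bigr => s _; rewrite /p big_ord_recl -mulmxE !mxE mulr_sumr.
apply: eq_bigr => l _.
rewrite permM lift_perm_id odd_permM odd_lift_perm odd_permV /= signr_addb.
congr (_ * (_ * _)); first by rewrite mulrAC -signr_addb addbb mul1r.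
by congr (fun_of_matrix _ _ _); apply: eq_bigr => j _;
   rewrite permM lift_perm_lift permK.
Qed.

Definition log_derivative (g : X -> 'M[C]_M) x c (v : 'rV[C]_n) : 'M[C]_M :=
  invmx (g x) *m \matrix_(a, b) dform (fun y => g y a b) x c v.

Lemma T_form_value (I : Type) (g : I -> I -> X -> 'M[C]_M) k
    (i : 'I_k.+1 -> I) x c A :
  T_form g i x c A = k.+1`!%:R^-1 * \sum_(s : 'S_k) (-1) ^+ s *
    \sum_(t : 'S_k.+1) (-1) ^+ t *
      \tr (\prod_l log_derivative (g (i (t (lift ord_max l))) (i (t ord_max)))
             x c (row (s l) A)).
Proof.
under [in RHS]eq_bigr do rewrite mulr_sumr.
rewrite exchange_big /= mulr_sumr; apply: eq_bigr => t _.
rewrite [(-1) ^+ t / _]mulrC -mulrA; congr (_ * _).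
under [RHS]eq_bigr do rewrite mulrCA.
rewrite -mulr_sumr; congr (_ * _); rewrite [X in X x c A]/mxtrace form_sumE.
under eq_bigr do rewrite wedge_prod_value.
transitivity (\tr (\sum_(s : 'S_k) (-1) ^+ s *: \prod_l log_derivative
  (g (i (t (lift ord_max l))) (i (t ord_max))) x c (row (s l) A))).
  congr (\tr _); apply: eq_bigr => s _; congr (_ *: _); apply: eq_bigr => l _.
  by apply/matrixP => a b; rewrite !mxE; apply: eq_bigr => j _; rewrite mxE.
by rewrite raddf_sum; apply: eq_bigr => s _; rewrite /= mxtraceZ.
Qed.

End Values.

(** * Calculus of holomorphic functions *)

Section Calculus.
Variables (C : numFieldType) (V : normedModType C).
Implicit Types (U : set V).

Lemma near_differentiable (W : normedModType C) (f g : V -> W) (x : V) :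
  (\near x, f x = g x) -> differentiable f x ->
  differentiable g x /\ ('d g x = 'd f x :> (V -> W)).
Proof.
move=> fg df; have dfc := diff_continuous df.
have fgx : f x = g x := nbhs_singleton fg.
have gE : g \o shift x = cst (g x) + 'd f x +o_ 0 id.
  apply/eqaddoP => _/posnumP[e].
  move/diff_locally/eqaddoP: df => /(_ _ [gt0 of e%:num]).
  move: fg; rewrite (near_shift 0) subr0 => fg dfe; near=> h.
  have fgh : (f \o shift x) h = (g \o shift x) h by near: h.
  rewrite -[(_ - _) h]/((g \o shift x) h - (g x + 'd f x h)) -fgh -fgx.
  by near: h.
have dgE := diff_unique dfc gE.
split=> //; apply/diff_locallyP; split; first by rewrite dgE.
by rewrite dgE.
Unshelve. all: by end_near. Qed.

Section ClassC.
Variable W : normedModType C.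
Implicit Types (f g : V -> W).

(** All the conditions in [class_C] are imposed at points of the set, on the
    derivatives of a total function. *)
Lemma class_C_local m U f :
  (forall x, U x -> exists2 U', U' x & class_C m U' f) -> class_C m U f.
Proof.
elim: m f => [|m IH] f loc /=.
  by move=> x /loc [U' U'x]; apply.
split=> [x /loc [U' U'x [df _]]|v]; first exact: df.
by apply: IH => x /loc [U' U'x [_ /(_ v)]]; exists U'.
Qed.

Lemma class_CS m U f : class_C m.+1 U f -> class_C m U f.
Proof.
elim: m f => [|m IH] f [df Df] /=.
  by move=> x /df; exact: differentiable_continuous.
by split=> // v; apply/IH/Df.
Qed.

(** Functions that agree on an open set have the same germs at its points, hence
    the same derivatives. *)
Lemma eq_class_C m U f g : open U -> (forall x, U x -> f x = g x) ->
  class_C m U f -> class_C m U g.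
Proof.
move=> oU; have nearU x : U x -> \near x, U x by move=> Ux; exact: open_nbhs_nbhs.
elim: m f g => [|m IH] f g fg /=.
  move=> fC x Ux; have fgx : \near x, f x = g x by apply: filterS (nearU x Ux).
  suff : g @ x --> f x by rewrite (fg _ Ux).
  by apply: cvg_trans (fC x Ux); exact: near_eq_cvg.
move=> [df Df]; split=> [x Ux|v].
  by apply: (near_differentiable _ (df x Ux)).1; apply: filterS (nearU x Ux).
apply: IH (Df v) => x Ux; apply: near_eq_derive.
by apply: filterS (nearU x Ux).
Qed.

Lemma class_C_cst m U (a : W) : class_C m U (cst a).
Proof.
elim: m a => [|m IH] a /=; first by move=> x _; exact: cst_continuous.
split=> [x _|v]; first exact: differentiable_cst.
have -> : 'D_v (cst a) = cst 0 :> (V -> W) by apply/funext => x; rewrite derive_cst.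
exact: IH.
Qed.

Lemma class_CD m U f g : open U ->
  class_C m U f -> class_C m U g -> class_C m U (fun x => f x + g x).
Proof.
move=> oU; elim: m f g => [|m IH] f g /=.
  by move=> fC gC x Ux; apply: cvgD; [exact: fC | exact: gC].
move=> [df Df] [dg Dg]; split=> [x Ux|v].
  exact: differentiableD (df x Ux) (dg x Ux).
apply: eq_class_C (IH _ _ (Df v) (Dg v)) => // x Ux.
by rewrite -deriveD; [|apply: diff_derivable..]; [|exact: df|exact: dg].
Qed.

End ClassC.

Lemma class_CM m U (f g : V -> C) : open U ->
  class_C m U f -> class_C m U g -> class_C m U (fun x => f x * g x).
Proof.
move=> oU; elim: m f g => [|m IH] f g.
  by move=> fC gC x Ux; apply: cvgM; [exact: fC | exact: gC].
move=> fC gC; have fC' := class_CS fC; have gC' := class_CS gC.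
case: fC gC => [df Df] [dg Dg]; split=> [x Ux|v].
  exact: differentiableM (df x Ux) (dg x Ux).
apply: eq_class_C (class_CD oU (IH _ _ fC' (Dg v)) (IH _ _ gC' (Df v))) => // x Ux.
by rewrite (deriveM (f := f) (g := g)) //; apply: diff_derivable; [exact: df|exact: dg].
Qed.

Implicit Types (f g : V -> C).

Lemma holomorphic_local U f :
  (forall x, U x -> exists2 U', U' x & holomorphic U' f) -> holomorphic U f.
Proof.
by move=> loc m; apply: class_C_local => x /loc [U' U'x fU]; exists U' => //; apply: fU.
Qed.

Lemma eq_holomorphic U f g : open U -> (forall x, U x -> f x = g x) ->
  holomorphic U f -> holomorphic U g.
Proof. by move=> oU fg fC m; apply: eq_class_C (fC m). Qed.

Lemma holomorphic_differentiable (W : normedModType C) U (f : V -> W) x :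
  holomorphic U f -> U x -> differentiable f x.
Proof. by move=> /(_ 1) [df _]; exact: df. Qed.

Lemma holomorphic_derive U f v : holomorphic U f -> holomorphic U ('D_v f).
Proof. by move=> fC m; have [_ Df] := fC m.+1; exact: Df. Qed.

Lemma holomorphic_cst U (a : C) : holomorphic U (fun=> a : C).
Proof. by move=> m; exact: class_C_cst. Qed.

Lemma holomorphicD U f g : open U -> holomorphic U f -> holomorphic U g ->
  holomorphic U (fun x => f x + g x).
Proof. by move=> oU fC gC m; apply: class_CD. Qed.

Lemma holomorphicM U f g : open U -> holomorphic U f -> holomorphic U g ->
  holomorphic U (fun x => f x * g x).
Proof. by move=> oU fC gC m; apply: class_CM. Qed.

Lemma holomorphic_sum U (I : Type) (r : seq I) (P : pred I) (f : I -> V -> C) :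
  open U -> (forall i, P i -> holomorphic U (f i)) ->
  holomorphic U (fun x => \sum_(i <- r | P i) f i x).
Proof.
move=> oU fC; elim: r => [|i r IH].
  by under eq_fun do rewrite big_nil; exact: holomorphic_cst.
case Pi: (P i); under eq_fun do rewrite big_cons Pi; last exact: IH.
by apply: holomorphicD => //; exact: fC.
Qed.

Definition holomorphic_mx M U (G : V -> 'M[C]_M) : Prop :=
  forall a b, holomorphic U (fun x => G x a b).

Lemma holomorphic_mulmx M U (G H : V -> 'M[C]_M) : open U ->
  holomorphic_mx U G -> holomorphic_mx U H ->
  holomorphic_mx U (fun x => G x *m H x).
Proof.
move=> oU GC HC a b; under eq_fun do rewrite mxE.
by apply: holomorphic_sum => // l _; exact: holomorphicM.
Qed.

Lemma holomorphic_prod M U k (G : 'I_k -> V -> 'M[C]_M) : open U ->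
  (forall l, holomorphic_mx U (G l)) ->
  holomorphic_mx U (fun x => \prod_l G l x).
Proof.
move=> oU; elim: k G => [|k IH] G GC.
  move=> a b; under eq_fun do rewrite big_ord0; exact: holomorphic_cst.
under eq_fun do rewrite big_ord_recl -mulmxE.
apply: (holomorphic_mulmx (H := fun x => \prod_l G (lift ord0 l) x)) => //.
exact: IH.
Qed.

Lemma holomorphic_trace M U (G : V -> 'M[C]_M) : open U ->
  holomorphic_mx U G -> holomorphic U (fun x => \tr (G x)).
Proof. by move=> oU GC; apply: holomorphic_sum => // a _; exact: GC. Qed.

End Calculus.

(** * Differentials of holomorphic functions on a manifold *)

Section Manifold.
Variables (C : numFieldType) (n : nat) (X : complexManifold C n).
Implicit Types (W : set X) (c : chart X) (f : X -> C).

Lemma chart_image_open W c : open W -> open (cmap c @` (W `&` cdom c)).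
Proof.
move=> oW; rewrite openE => _ [x [Wx cx] <-]; rewrite /interior.
have zc : (cmap c @` cdom c) (cmap c x) by exists x.
have nW : nbhs (cinv c (cmap c x)) W.
  by rewrite cmapK //; exact: open_nbhs_nbhs.
have nZ : nbhs (cmap c x) (cmap c @` cdom c).
  by apply: open_nbhs_nbhs; split=> //; exact: cimg_open.
have nWZ := cinv_continuous zc nW; near=> z.
have [y cy yz] : (cmap c @` cdom c) z by near: z.
exists y => //; split=> //; rewrite -(cmapK cy) yz; near: z; exact: nWZ.
Unshelve. all: by end_near. Qed.

Lemma holo_fun_local W f :
  (forall x, W x -> exists2 W', W' x & holo_fun W' f) -> holo_fun W f.
Proof.
move=> loc c; apply: holomorphic_local => _ [x [/loc [W' W'x fW'] cx] <-].
by exists (cmap c @` (W' `&` cdom c)); [exists x | exact: fW'].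
Qed.

Lemma holo_fun_sub W W' f : W' `<=` W -> holo_fun W f -> holo_fun W' f.
Proof.
by move=> W'W fW; apply: holo_fun_local => x /W'W Wx; exists W.
Qed.

Lemma eq_holo_fun W f g : open W -> (forall x, W x -> f x = g x) ->
  holo_fun W f -> holo_fun W g.
Proof.
move=> oW fg fW c; apply: eq_holomorphic (fW c); first exact: chart_image_open.
by move=> _ [x [Wx cx] <-] /=; rewrite cmapK // fg.
Qed.

Lemma holo_mx_comp M W (g : X -> 'M[C]_M) c :
  holo_mx W g -> holomorphic_mx (cmap c @` (W `&` cdom c)) (g \o cinv c).
Proof. by move=> gW a b; exact: gW. Qed.

Lemma holo_mulmx M W (g h : X -> 'M[C]_M) : open W ->
  holo_mx W g -> holo_mx W h -> holo_mx W (fun x => g x *m h x).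
Proof.
move=> oW gW hW a b c.
exact: (holomorphic_mulmx (chart_image_open (c := c) oW)
  (holo_mx_comp c gW) (holo_mx_comp c hW) a b).
Qed.

Lemma holo_differentiable W f c x : holo_fun W f -> W x -> cdom c x ->
  differentiable (f \o cinv c) (cmap c x).
Proof.
by move=> fW Wx cx; apply: holomorphic_differentiable (fW c) _; exists x.
Qed.

Lemma dform_derive W f c x v : holo_fun W f -> W x -> cdom c x ->
  dform f x c v = 'D_v (f \o cinv c) (cmap c x).
Proof.
move=> fW Wx cx; rewrite /dform mem_set // deriveE //.
exact: holo_differentiable cx.
Qed.

Lemma dform_out f c x v : ~ cdom c x -> dform f x c v = 0.
Proof. by move=> cx; rewrite /dform memNset. Qed.

Lemma dform_linear f c x (a b : C) (v w : 'rV[C]_n) :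
  dform f x c (a *: v + b *: w) = a * dform f x c v + b * dform f x c w.
Proof.
rewrite /dform; case: ifP => _; last by rewrite !mulr0 addr0.
by rewrite linearD !linearZ.
Qed.

Lemma dform_eq W f g c x v : open W -> (forall y, W y -> f y = g y) ->
  holo_fun W f -> W x -> cdom c x -> dform f x c v = dform g x c v.
Proof.
move=> oW fg fW Wx cx.
rewrite (dform_derive _ fW) // (dform_derive _ (eq_holo_fun oW fg fW)) //.
apply: near_eq_derive; have oZ := chart_image_open (c := c) oW.
have Zx : (cmap c @` (W `&` cdom c)) (cmap c x) by exists x.
apply: filterS (open_nbhs_nbhs (conj oZ Zx)) => _ [y [Wy cy] <-] /=.
by rewrite cmapK // fg.
Qed.

(** The chain rule for the change of coordinates [cmap c' \o cinv c]. *)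
Lemma dform_chart W f c c' x v : holo_fun W f -> W x -> cdom c x -> cdom c' x ->
  dform f x c v = dform f x c' (v *m coord_jacobian c c' x).
Proof.
move=> fW Wx cx c'x; rewrite /dform !mem_set //.
pose h := cmap c' \o cinv c.
have hx : h (cmap c x) = cmap c' x by rewrite /h /= cmapK.
have Zx : (cmap c @` (cdom c `&` cdom c')) (cmap c x) by exists x.
have dh : differentiable h (cmap c x).
  exact: holomorphic_differentiable (@chart_compat _ _ _ c c') Zx.
have df : differentiable (f \o cinv c') (h (cmap c x)).
  by rewrite hx; exact: holo_differentiable c'x.
have near_fh : \forall z \near cmap c x,
    ((f \o cinv c') \o h) z = (f \o cinv c) z.
  have oZ : open (cmap c @` (cdom c `&` cdom c')).
    by rewrite setIC; apply: chart_image_open; exact: cdom_open.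
  apply: filterS (open_nbhs_nbhs (conj oZ Zx)) => _ [y [cy c'y] <-] /=.
  by rewrite /h /= cmapK // cmapK.
have [_ dE] := near_differentiable near_fh (differentiable_comp dh df).
pose ev (F : 'rV[C]_n -> C) := F v.
apply: (etrans (congr1 ev dE)); apply: (etrans (congr1 ev (diff_comp dh df))).
by rewrite /ev /= /coord_jacobian /jacobian mul_rV_lin1 -hx.
Qed.

Section MatrixFunctions.
Variable M : nat.
Implicit Types g h : X -> 'M[C]_M.

Definition dform_mx g x c (v : 'rV[C]_n) : 'M[C]_M :=
  \matrix_(a, b) dform (fun y => g y a b) x c v.

Lemma dform_mx_eq W g h c x v : open W -> (forall y, W y -> g y = h y) ->
  holo_mx W g -> W x -> cdom c x -> dform_mx g x c v = dform_mx h x c v.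
Proof.
move=> oW gh gW Wx cx; apply/matrixP => a b; rewrite !mxE.
by apply: (dform_eq v oW _ (gW a b)) => // y Wy; rewrite gh.
Qed.

Lemma dform_mxM W g h c x v : open W -> holo_mx W g -> holo_mx W h ->
  W x -> cdom c x ->
  dform_mx (fun y => g y *m h y) x c v =
  dform_mx g x c v *m h x + g x *m dform_mx h x c v.
Proof.
move=> oW gW hW Wx cx; apply/matrixP => a b.
have dg l : derivable ((fun y => g y a l) \o cinv c) (cmap c x) v.
  by apply: diff_derivable; exact: (holo_differentiable (gW a l)).
have dh l : derivable ((fun y => h y l b) \o cinv c) (cmap c x) v.
  by apply: diff_derivable; exact: (holo_differentiable (hW l b)).
rewrite mxE (dform_derive _ (holo_mulmx oW gW hW a b)) //.
have -> : (fun y => (g y *m h y) a b) \o cinv c =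
    \sum_l ((fun y => g y a l) \o cinv c) * ((fun y => h y l b) \o cinv c).
  by apply/funext => z; rewrite fct_sumE /= mxE.
rewrite derive_sum => [|l]; last exact: derivableM.
rewrite !mxE -big_split; apply: eq_bigr => l _ /=.
rewrite deriveM // !mxE /= !cmapK // (dform_derive _ (gW a l)) //.
rewrite (dform_derive _ (hW l b)) // addrC; congr (_ + _).
exact: mulrC.
Qed.

Lemma log_derivativeE g x c v :
  log_derivative g x c v = invmx (g x) *m dform_mx g x c v.
Proof. by []. Qed.

Lemma log_derivative_out g x c v : ~ cdom c x -> log_derivative g x c v = 0.
Proof.
move=> cx; rewrite log_derivativeE (_ : dform_mx g x c v = 0) ?mulmx0 //.
by apply/matrixP => a b; rewrite !mxE dform_out.
Qed.

Lemma log_derivative_linear g x c (a b : C) v w :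
  log_derivative g x c (a *: v + b *: w) =
  a *: log_derivative g x c v + b *: log_derivative g x c w.
Proof.
rewrite !log_derivativeE !scalemxAr -mulmxDr; congr (_ *m _).
by apply/matrixP => p q; rewrite !mxE dform_linear.
Qed.

Lemma log_derivative_chart W g x c c' v : holo_mx W g ->
  W x -> cdom c x -> cdom c' x ->
  log_derivative g x c v = log_derivative g x c' (v *m coord_jacobian c c' x).
Proof.
move=> gW Wx cx c'x; congr (_ *m _); apply/matrixP => a b; rewrite !mxE.
exact: (dform_chart _ (gW a b)).
Qed.

End MatrixFunctions.
End Manifold.

(** * The T form of a system of transition functions *)

Lemma trace_prod_conj (C : numFieldType) M k (P Q : 'M[C]_M)
    (Y : 'I_k -> 'M[C]_M) : P *m Q = 1%:M -> Q *m P = 1%:M ->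
  \tr (\prod_l (P *m Y l *m Q)) = \tr (\prod_l Y l).
Proof.
move=> PQ QP; suff -> : \prod_l (P *m Y l *m Q) = P *m \prod_l Y l *m Q.
  by rewrite mxtrace_mulC mulmxA QP mul1mx.
elim: k Y => [|k IH] Y; first by rewrite !big_ord0 mulmx1.
rewrite !big_ord_recl -!mulmxE IH !mulmxA; congr (_ *m _ *m _).
by rewrite -!mulmxA QP mulmx1.
Qed.


Section TForm.
Variables (C : numFieldType) (n : nat) (X : complexManifold C n) (M : nat).
Variables (J : Type) (W : set X).
Hypothesis oW : open W.

(** The indices in [J] stand for frames over all of [W]. *)
Definition gl_cocycle (g : J -> J -> X -> 'M[C]_M) : Prop :=
  [/\ forall a b, holo_mx W (g a b), forall x a, W x -> g a a x = 1%:M &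
      forall x a b d, W x -> g a b x *m g b d x = g a d x].

Variable g : J -> J -> X -> 'M[C]_M.
Hypothesis gP : gl_cocycle g.

Lemma gl_cocycleV x a b : W x -> invmx (g a b x) = g b a x.
Proof.
move=> Wx; have [_ g1 gM] := gP.
have gV : g a b x *m g b a x = 1%:M by rewrite gM // g1.
by rewrite -[RHS](mulKmx (mulmx1_unit gV).1) gV mulmx1.
Qed.

(** Differentiating [g a b *m g b o = g a o] expresses the logarithmic
    derivatives of all the transition functions through those of the frames
    relative to the frame [o]. *)
Lemma log_derivative_base x c v a b o : W x -> cdom c x ->
  log_derivative (g a b) x c v =
  g b o x *m (log_derivative (g a o) x c v - log_derivative (g b o) x c v)
    *m g o b x.
Proof.
move=> Wx cx; have [gW g1 gM] := gP.
have := dform_mxM v oW (gW a b) (gW b o) Wx cx.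
rewrite (dform_mx_eq v oW (h := g a o)) //; last 2 first.
- by move=> y Wy; rewrite gM.
- exact: holo_mulmx.
move=> dE; rewrite !log_derivativeE !gl_cocycleV // dE.
rewrite !mulmxDr mulmxN !mulmxA (gM x b o a) // (gM x b a b) // (gM x b o b) //.
by rewrite addrK -!mulmxA (gM x b o b) // g1 // mulmx1.
Qed.

(** Relative to a frame [o], the factors of the T form are differences
    conjugated by one and the same matrix, which the trace does not see. *)
Lemma T_form_base k (i : 'I_k.+1 -> J) x c A o : W x -> cdom c x ->
  T_form g i x c A = k`!%:R^-1 * \sum_(s : 'S_k) (-1) ^+ s *
    signed_trace (fun a l => log_derivative (g (i a) o) x c (row (s l) A)).
Proof.
move=> Wx cx; have [_ g1 gM] := gP; rewrite T_form_value.
pose th s a l := log_derivative (g (i a) o) x c (row ((s : 'S_k) l) A).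
transitivity (k.+1`!%:R^-1 * \sum_(s : 'S_k) (-1) ^+ s *
    (k.+1%:R * signed_trace (th s))).
  congr (_ * _); apply: eq_bigr => s _; congr (_ * _).
  rewrite -signed_trace_differences; apply: eq_bigr => t _; congr (_ * _).
  rewrite -[RHS](@trace_prod_conj _ _ _ (g (i (t ord_max)) o x)
                   (g o (i (t ord_max)) x)); try by rewrite gM // g1.
  by congr (\tr _); apply: eq_bigr => l _; rewrite (log_derivative_base _ _ _ o).
under eq_bigr do rewrite mulrCA.
rewrite -mulr_sumr mulrA; congr (_ * _).
by rewrite factS natrM invfM mulrAC mulVf ?mul1r // pnatr_eq0.
Qed.

(** In degree 0 the empty product would give the constant [M]. *)
Lemma T_form_out k (i : 'I_k.+1 -> J) x c A : (0 < k)%N -> ~ cdom c x ->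
  T_form g i x c A = 0.
Proof.
case: k i A => // k i A _ cx; rewrite T_form_value big1 ?mulr0 // => s _.
rewrite big1 ?mulr0 // => t _.
by rewrite big_ord_recl log_derivative_out // mul0r mxtrace0 mulr0.
Qed.

(** All the terms are signed traces for one common frame [i ord0]. *)
Lemma T_form_cocycle k (i : 'I_k.+2 -> J) x c A : (0 < k)%N -> W x ->
  \sum_(j < k.+2) (-1) ^+ j * T_form g (i \o lift j) x c A = 0.
Proof.
move=> k_gt0 Wx; have [cx|cx] := pselect (cdom c x); last first.
  by rewrite big1 // => j _; rewrite T_form_out // mulr0.
under eq_bigr do rewrite (T_form_base _ _ (i ord0) Wx cx) mulrCA mulr_sumr.
rewrite -mulr_sumr exchange_big /= big1 ?mulr0 // => s _.
under eq_bigr do rewrite mulrCA.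
rewrite -mulr_sumr.
rewrite (signed_trace_cocycle
  (fun a l => log_derivative (g (i a) (i ord0)) x c (row (s l) A))).
by rewrite mulr0.
Qed.

(** Each row of the argument enters exactly one factor of each product. *)
Lemma T_form_multilinear k (i : 'I_k.+1 -> J) x c : multilinear (T_form g i x c).
Proof.
move=> A B D i0 b d rowA rowB rowD; rewrite !T_form_value.
have rowE (E : 'M[C]_(k, n)) j : row' i0 E = row' i0 A -> j != i0 ->
    row j E = row j A.
  rewrite eq_sym => EA /unlift_some[j' -> _]; apply/rowP => q.
  by have /matrixP/(_ j' q) := EA; rewrite !mxE.
rewrite !(mulrCA _ (k.+1`!%:R^-1)) -mulrDr; congr (_ * _).
rewrite !mulr_sumr -big_split; apply: eq_bigr => s _ /=.
rewrite !(mulrCA _ ((-1) ^+ s)) -mulrDr; congr (_ * _).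
rewrite !mulr_sumr -big_split; apply: eq_bigr => t _ /=.
rewrite !(mulrCA _ ((-1) ^+ t)) -mulrDr; congr (_ * _).
pose L l E := log_derivative (g (i (t (lift ord_max l))) (i (t ord_max))) x c
  (row (s l) (E : 'M[C]_(k, n))).
rewrite -!mxtraceZ -mxtraceD; congr (\tr _).
apply: (@prod_slot _ _ _ (s^-1%g i0) (L^~ A) (L^~ B) (L^~ D)).
- by rewrite /L permKV rowA log_derivative_linear.
- move=> l ls; rewrite /L (rowE B) //.
  by apply: contra_neq ls => <-; rewrite permK.
- move=> l ls; rewrite /L (rowE D) //.
  by apply: contra_neq ls => <-; rewrite permK.
Qed.

Lemma T_form_alternate k (i : 'I_k.+1 -> J) x c : alternate (T_form g i x c).
Proof.
move=> A i1 i2 neq_i rowA; rewrite T_form_value (reindex_inj (@invg_inj {perm 'I_k})) /=.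
under eq_bigr do rewrite odd_permV.
rewrite (@signed_sum_eq0 _ _ (fun s : 'S_k => \sum_(t : 'S_k.+1) _) _ _ neq_i)
  ?mulr0 // => s.
apply: eq_bigr => t _; congr (_ * \tr _); apply: eq_bigr => l _.
congr log_derivative; rewrite invgM tpermV permM.
by case: tpermP => [->|->|].
Qed.

Lemma T_form_chart k (i : 'I_k.+1 -> J) x c c' A :
  W x -> cdom c x -> cdom c' x ->
  T_form g i x c A = T_form g i x c' (A *m coord_jacobian c c' x).
Proof.
move=> Wx cx c'x; have [gW _ _] := gP; rewrite !T_form_value; congr (_ * _).
apply: eq_bigr => s _; congr (_ * _); apply: eq_bigr => t _.
congr (_ * \tr _); apply: eq_bigr => l _.
by rewrite row_mul (log_derivative_chart _ (gW _ _) Wx cx c'x).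
Qed.

(** The inverse of [g a b] being [g b a], the values of the T form are
    polynomials in holomorphic functions and their derivatives. *)
Lemma T_form_holomorphic k (i : 'I_k.+1 -> J) c A :
  holomorphic (cmap c @` (W `&` cdom c)) (fun z => T_form g i (cinv c z) c A).
Proof.
have [gW _ _] := gP; have oZ := chart_image_open (c := c) oW.
pose D a b v z : 'M[C]_M :=
  g b a (cinv c z) *m \matrix_(p, q) 'D_v ((fun y => g a b y p q) \o cinv c) z.
have Dholo a b v : holomorphic_mx (cmap c @` (W `&` cdom c)) (D a b v).
  apply: (holomorphic_mulmx oZ (holo_mx_comp c (gW b a))) => p q.
  under eq_fun do rewrite mxE.
  exact: (holomorphic_derive v (gW a b p q c)).
pose F z := k.+1`!%:R^-1 * \sum_(s : 'S_k) (-1) ^+ s *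
  \sum_(t : 'S_k.+1) (-1) ^+ t * \tr (\prod_l
    D (i (t (lift ord_max l))) (i (t ord_max)) (row (s l) A) z).
apply: (@eq_holomorphic _ _ _ F) => //.
  move=> _ [x [Wx cx] <-]; rewrite cmapK // T_form_value /F; congr (_ * _).
  apply: eq_bigr => s _; congr (_ * _); apply: eq_bigr => t _.
  congr (_ * \tr _); apply: eq_bigr => l _.
  rewrite /D cmapK // /log_derivative gl_cocycleV //; congr (_ *m _).
  by apply/matrixP => p q; rewrite !mxE (dform_derive _ (gW _ _ p q)).
apply: holomorphicM => //; first exact: holomorphic_cst.
apply: holomorphic_sum => // s _; apply: holomorphicM => //.
  exact: holomorphic_cst.
apply: holomorphic_sum => // t _; apply: holomorphicM => //.
  exact: holomorphic_cst.
by apply: holomorphic_trace => //; apply: holomorphic_prod.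
Qed.

Lemma T_form_Omega k (i : 'I_k.+1 -> J) : (0 < k)%N ->
  Omega X k W (restr W (T_form g i)).
Proof.
move=> k_gt0.
have TW x : W x -> restr W (T_form g i) x = T_form g i x.
  by move=> Wx; rewrite /restr patchT // mem_set.
split.
- move=> x c nWc; apply/funext => A; have [Wx|Wx] := pselect (W x).
    by rewrite TW // T_form_out // => cx; apply: nWc.
  by rewrite /restr patchC // mem_set.
- move=> x c Wx cx; rewrite TW //; split; first exact: T_form_multilinear.
  exact: T_form_alternate.
- by move=> x c c' A Wx cx c'x; rewrite TW //; exact: T_form_chart.
- move=> c A; apply: eq_holomorphic (T_form_holomorphic i c A).
    exact: chart_image_open.
  by move=> _ [x [Wx cx] <-]; rewrite cmapK // TW.
Qed.

End TForm.

Lemma signed_sum_perm (C : numFieldType) k (J : Type) (b : C)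
    (f : ('I_k -> J) -> C) (i : 'I_k -> J) (t : 'S_k) :
  \sum_(s : 'S_k) (-1) ^+ s / b * f (i \o t \o s) =
  (-1) ^+ t * \sum_(s : 'S_k) (-1) ^+ s / b * f (i \o s).
Proof.
rewrite [in RHS](reindex_inj (mulIg t)) mulr_sumr.
apply: eq_bigr => s _; rewrite odd_permM signr_addb mulrA; congr (_ * _).
  by rewrite mulrA [(-1) ^+ s * (-1) ^+ t]mulrC signrMK.
by congr f; apply/funext => l; rewrite /= permM.
Qed.

Lemma T_form_perm (C : numFieldType) n (X : complexManifold C n) M (J : Type)
    (g : J -> J -> X -> 'M[C]_M) k (i : 'I_k.+1 -> J) (t : 'S_k.+1) :
  T_form g (i \o t) = T_form g i *~ (-1) ^+ t.
Proof.
have TE x c A : T_form g (i \o t) x c A = (-1) ^+ t * T_form g i x c A.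
  pose f (j : 'I_k.+1 -> J) := (\tr (wedge_prod (fun l : 'I_k =>
    inv_mul_d (g (j (lift ord_max l)) (j ord_max))))) x c A.
  exact: (signed_sum_perm _ f).
apply/funext => x; apply/funext => c; apply/funext => A; rewrite TE.
by case: (odd_perm t); rewrite !(expr0, expr1) ?mulN1r ?mul1r.
Qed.

(** * Alternating Cech cochains *)

Section Cochains.
Variables (T : topologicalType) (V : zmodType) (S : set T -> set (T -> V)).
Hypothesis V2 : forall v : V, v = - v -> v = 0.
Hypothesis S0 : forall W, open W -> S W 0.
Hypothesis SB : forall W f g, open W -> S W f -> S W g -> S W (f - g).
Variable U : open_cover T.

Lemma mulz_signV (W : zmodType) (v : W) (b : bool) :
  v *~ (-1) ^+ b = if b then - v else v.
Proof. by case: b; rewrite ?expr1 ?mulrN1z ?expr0 ?mulr1z. Qed.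

Lemma section_sign W f (b : bool) : open W -> S W f -> S W (f *~ (-1) ^+ b).
Proof.
move=> oW Sf; rewrite mulz_signV; case: b => //; rewrite -sub0r.
by apply: SB => //; exact: S0.
Qed.

Lemma section_sum W (J : Type) (r : seq J) (P : pred J) (f : J -> T -> V) :
  open W -> (forall j, S W (f j)) -> S W (\sum_(j <- r | P j) f j).
Proof.
move=> oW Sf; elim/big_rec: _ => [|j h _ Sh]; first exact: S0.
rewrite -[h]opprK; apply: SB => //; rewrite -sub0r.
by apply: SB => //; exact: S0.
Qed.

Lemma cap_open q (i : 'I_q -> cover_idx U) : open (cap i).
Proof.
rewrite openE => x capx; apply: filter_forall => a.
by apply: open_nbhs_nbhs; split; [exact: cover_open | exact: capx].
Qed.

Lemma restrE W (f : T -> V) x : W x -> restr W f x = f x.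
Proof. by move=> Wx; rewrite /restr patchT // mem_set. Qed.

Lemma restr_out W (f : T -> V) x : ~ W x -> restr W f x = 0.
Proof. by move=> Wx; rewrite /restr patchC // mem_set. Qed.

Lemma restrB W (f g : T -> V) : restr W (f - g) = restr W f - restr W g.
Proof.
apply/funext => x; have [Wx|Wx] := pselect (W x).
  by rewrite !fctE !restrE.
by rewrite !fctE !restr_out // subr0.
Qed.

Lemma restr_sign W (f : T -> V) (b : bool) :
  restr W (f *~ (-1) ^+ b) = restr W f *~ (-1) ^+ b.
Proof.
rewrite !mulz_signV; case: b => //.
by rewrite -[- f]add0r restrB -[RHS]add0r; congr (_ - _);
  apply/funext => x; rewrite /restr /patch; case: ifP.
Qed.

Section Degree.
Variable q : nat.
Implicit Types (t : raw_cochain V U q) (i : 'I_q.+1 -> cover_idx U).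

Definition alternating (V' : zmodType) (t : ('I_q.+1 -> cover_idx U) -> V') :=
  forall i (s : 'S_q.+1), t (i \o s) = t i *~ (-1) ^+ s.

Lemma increasingP i : reflect (forall a b : 'I_q.+1, (a < b)%N -> (i a < i b)%O)
  (increasing i).
Proof.
by apply: (iffP 'forall_forallP) => H a b; [move/implyP: (H a b) | apply/implyP; exact: H].
Qed.

Lemma cap_perm i (s : 'S_q.+1) : cap (i \o s) = cap i.
Proof.
apply/seteqP; split=> x capx a /=; last exact: capx.
by rewrite -(permKV s a); exact: capx.
Qed.

(** At most one term of the sum defining [alt_ext] is present. *)
Lemma increasing_perm_eq1 i (s : 'S_q.+1) :
  increasing i -> increasing (i \o s) -> s = 1%g.
Proof.
move=> /increasingP inc /increasingP incs.
have mono (a b : 'I_q.+1) : (a < b)%N -> (s a < s b)%N.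
  move=> /incs /= lt_ab; case: ltngtP => // [/inc|/val_inj sab].
    by move/(lt_trans lt_ab); rewrite ltxx.
  by rewrite sab ltxx in lt_ab.
have le_mono (u : 'S_q.+1) : (forall a b : 'I_q.+1, (a < b)%N -> (u a < u b)%N) ->
    forall a : 'I_q.+1, (a <= u a)%N.
  move=> umono [a]; elim: a => [|a IH] lta //=.
  have lta' : (a < q.+1)%N by exact: ltnW.
  exact: leq_ltn_trans (IH lta') (umono (Ordinal lta') (Ordinal lta) (ltnSn _)).
apply/permP => a; rewrite perm1; apply/val_inj/eqP; rewrite eqn_leq le_mono // andbT.
have monoV (b c : 'I_q.+1) : (b < c)%N -> ((s^-1)%g b < (s^-1)%g c)%N.
  move=> bc; case: ltngtP => // [/mono|/val_inj sbc].
    by rewrite !permKV => /(ltn_trans bc); rewrite ltnn.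
  by rewrite -(permKV s b) sbc permKV ltnn in bc.
by have := le_mono _ monoV (s a); rewrite permK.
Qed.

Lemma sort_perm i : injective i -> exists s : 'S_q.+1, increasing (i \o s).
Proof.
move=> i_inj; pose l := [tuple i a | a < q.+1].
pose r := sort <=%O l.
have sz : size r == q.+1 by rewrite size_sort size_tuple.
have : perm_eq (Tuple sz) l by rewrite perm_sort.
case/tuple_permP => s rE; exists s; apply/increasingP => a b ab.
have rs : sorted <%O r.
  rewrite lt_sorted_uniq_le sort_uniq sort_le_sorted andbT.
  by rewrite map_inj_uniq ?enum_uniq.
have rn (c : 'I_q.+1) x0 : nth x0 r c = i (s c).
  by rewrite -[r]/(tval (Tuple sz)) rE -tnth_nth !tnth_mktuple.
have := sorted_ltn_nth lt_trans (i a) rs a b.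
by rewrite !inE (eqP sz) !ltn_ord !rn; apply.
Qed.

(** A transposition fixes the tuple and reverses the sign. *)
Lemma alternating_noninj (V' : zmodType)
    (t : ('I_q.+1 -> cover_idx U) -> V') i :
  (forall v : V', v = - v -> v = 0) ->
  alternating t -> ~ injective i -> t i = 0.
Proof.
move=> V'2 alt_t ninj; apply: V'2.
have [a [b [nab iab]]] : exists a b, a != b /\ i a = i b.
  apply: contrapT => nex; apply: ninj => a b iab; apply/eqP/negPn/negP => nab.
  by apply: nex; exists a, b.
rewrite -[X in X = _](_ : t (i \o tperm a b) = t i).
  by rewrite alt_t odd_tperm nab mulz_signV.
by congr t; apply/funext => c /=; case: tpermP => [->|->|].
Qed.

Lemma alt_ext_increasing t i : increasing i -> alt_ext t i = t i.
Proof.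
move=> inc; rewrite /alt_ext (big_pred1 (1%g : 'S_q.+1)) => [|s] /=.
  by rewrite odd_perm1 mulz_signV; congr t; apply/funext => a /=; rewrite perm1.
apply/idP/eqP => [incs|->]; first exact: increasing_perm_eq1 inc incs.
by rewrite (_ : i \o _ = i) //; apply/funext => a /=; rewrite perm1.
Qed.

Lemma alt_ext_alternating t : alternating (alt_ext t).
Proof.
move=> i s; rewrite /alt_ext.
rewrite [in RHS](reindex_inj (mulIg s)) mulrz_suml.
apply: eq_big => [u|u _].
  by congr increasing; apply/funext => a /=; rewrite permM.
rewrite odd_permM signr_addb -[RHS]mulrzA -mulrA -signr_addb addbb expr0 mulr1.
by congr (t _ *~ _); apply/funext => a /=; rewrite permM.
Qed.

Lemma T2 (f : T -> V) : f = - f -> f = 0.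
Proof. by move=> fN; apply/funext => x; apply: V2; exact: (congr1 (@^~ x) fN). Qed.

Lemma alt_ext_id t : alternating t -> alt_ext t = t.
Proof.
move=> alt_t; apply/funext => i; have [inj|ninj] := pselect (injective i).
  have [s inc] := sort_perm inj.
  have := alt_ext_increasing t inc; rewrite alt_t alt_ext_alternating.
  by rewrite !mulz_signV; case: (odd_perm s) => // /oppr_inj.
rewrite (alternating_noninj T2 alt_t ninj).
exact: alternating_noninj T2 (alt_ext_alternating t) ninj.
Qed.

(** An alternating cochain is its own alternating extension, which evaluates it
    at increasing tuples only. *)
Lemma eq_alternating t t' : alternating t -> alternating t' ->
  (forall i, increasing i -> t i = t' i) -> t = t'.
Proof.
move=> alt_t alt_t' tt'; rewrite -(alt_ext_id alt_t) -(alt_ext_id alt_t').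
by apply/funext => i; apply: eq_bigr => s inc; rewrite tt'.
Qed.

Lemma cochain_alternating t : cochain S t -> alternating t.
Proof. by move=> [_ <-]; exact: alt_ext_alternating. Qed.

Lemma cochainP t :
  (forall i, S (cap i) (t i)) -> alternating t -> cochain S t.
Proof. by move=> St alt_t; split=> //; exact: alt_ext_id. Qed.

Lemma alt_ext_cochain t : (forall i, S (cap i) (t i)) -> cochain S (alt_ext t).
Proof.
move=> St; apply: cochainP (alt_ext_alternating t) => i.
apply: section_sum => [|s]; first exact: cap_open.
by rewrite -(cap_perm i s); apply: section_sign; [exact: cap_open | exact: St].
Qed.

Lemma cochain0 : cochain S (0 : raw_cochain V U q).
Proof.
apply: cochainP => [i|i s]; first by apply: S0; exact: cap_open.
by rewrite -[LHS]/0 -[X in X *~ _]/0 mul0rz.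
Qed.

Lemma alternatingB t t' :
  alternating t -> alternating t' -> alternating (t - t').
Proof.
move=> alt_t alt_t' i s; rewrite -[LHS]/(t (i \o s) - t' (i \o s)).
by rewrite alt_t alt_t' -mulrzBl.
Qed.

Lemma cochainB t t' : cochain S t -> cochain S t' -> cochain S (t - t').
Proof.
move=> ct ct'; apply: cochainP => [i|].
  by apply: SB; [exact: cap_open | exact: ct.1 | exact: ct'.1].
exact: alternatingB (cochain_alternating ct) (cochain_alternating ct').
Qed.

Lemma cech_diffB t t' : cech_diff (t - t') = cech_diff t - cech_diff t'.
Proof.
apply/funext => i; rewrite -[RHS]/(cech_diff t i - cech_diff t' i) -restrB.
congr restr; rewrite -sumrB; apply: eq_bigr => j _.
by rewrite -mulrzBl.
Qed.

End Degree.

(** Deleting the index [j] from [i \o s] is deleting [s j] from [i] and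
    permuting the rest by the cofactor of [s]. *)
Lemma cech_diff_alternating q (t : raw_cochain V U q) :
  alternating t -> alternating (cech_diff t).
Proof.
move=> alt_t i s; rewrite /cech_diff cap_perm -restr_sign; congr restr.
rewrite mulrz_suml [in RHS](reindex_inj (@perm_inj _ s)); apply: eq_bigr => j _ /=.
pose u := perm_unlift j s.
have -> : (i \o s) \o lift j = (i \o lift (s j)) \o u.
  apply/funext => a /=; congr i.
  by rewrite -[in LHS](lift_perm_unlift j s) lift_perm_lift.
have -> : odd_perm s = odd j (+) odd (s j) (+) u.
  by rewrite -[in LHS](lift_perm_unlift j s) odd_lift_perm.
rewrite alt_t -!mulrzA -[(-1) ^+ j]signr_odd -[(-1) ^+ s j]signr_odd.
rewrite -!signr_addb; congr (_ *~ (-1) ^+ nat_of_bool _).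
by case: (odd j); case: (odd (s j)); case: (odd_perm u).
Qed.

Lemma cocycle0 q : cocycle S (0 : raw_cochain V U q).
Proof.
split; first exact: cochain0.
by rewrite -[X in cech_diff X](subrr (0 : raw_cochain V U q)) cech_diffB subrr.
Qed.

Lemma coboundaryB q (t t' : raw_cochain V U q) :
  coboundary S t -> coboundary S t' -> coboundary S (t - t').
Proof.
case: q t t' => [|q] t t' /=; first by move=> -> ->; rewrite subrr.
move=> [b cb ->] [b' cb' ->]; exists (b - b'); first exact: cochainB.
by rewrite cech_diffB.
Qed.

Lemma eq_coset q (t t' : raw_cochain V U q) :
  coboundary S (t - t') -> coset S t = coset S t'.
Proof.
move=> cob; have cob' : coboundary S (t' - t).
  by rewrite -opprB -sub0r -(subrr (t - t')); do 2![apply: coboundaryB => //].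
apply/seteqP; split=> u [cu cobu]; split=> //.
  have -> : u - t' = (u - t) - (t' - t) by rewrite opprB addrA subrK.
  exact: coboundaryB.
have -> : u - t = (u - t') - (t - t') by rewrite opprB addrA subrK.
exact: coboundaryB.
Qed.

End Cochains.

(** * The prism operator *)

(** The cancellations in the boundary of a prism: [F m l] is the [l]-th face of
    the [m]-th simplex, which is a face [G m j] of the prism over a face of the
    base, except for the two faces [R m] and [R m.+1] shared with the
    neighbouring simplices. *)
Lemma prism_sum (V : zmodType) n (F G : nat -> nat -> V) (R : nat -> V) :
  (forall m j, (j <= m <= n)%N -> F m.+1 j = - G m j) ->
  (forall m j, (m < j < n.+2)%N -> F m j.+1 = - G m j) ->
  (forall m, (m < n.+2)%N -> F m m = R m) ->
  (forall m, (m < n.+2)%N -> F m m.+1 = - R m.+1) ->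
  (forall m, (m < n.+2)%N -> \sum_(0 <= l < n.+3) F m l = 0) ->
  \sum_(0 <= m < n.+1) \sum_(0 <= j < n.+2) G m j = R 0 - R n.+2.
Proof.
move=> Flt Fgt Feq FeqS F0.
have split_row m : (m < n.+2)%N ->
    (\sum_(0 <= l < m) F m l) + (R m - R m.+1) +
    \sum_(m.+1 <= j < n.+2) F m j.+1 = 0.
  move=> mn; apply: etrans (F0 m mn).
  rewrite [RHS](big_cat_nat (n := m)) //=; last exact: ltnW (ltnW _).
  rewrite [X in _ = _ + X]big_ltn; last exact: ltnW.
  by rewrite [X in _ = _ + (_ + X)]big_ltn // Feq // FeqS // [in RHS]big_add1 /= !addrA.
have low : \sum_(0 <= m < n.+2) \sum_(0 <= l < m) F m l =
    - \sum_(0 <= m < n.+1) \sum_(0 <= j < m.+1) G m j.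
  rewrite big_nat_recl // [X in X + _]big_geq // add0r -sumrN; apply: eq_big_nat => m mn.
  rewrite -sumrN; apply: eq_big_nat => j jm; apply: Flt.
  by rewrite -ltnS (andP jm).2 -ltnS (andP mn).2.
have high : \sum_(0 <= m < n.+2) \sum_(m.+1 <= j < n.+2) F m j.+1 =
    - \sum_(0 <= m < n.+1) \sum_(m.+1 <= j < n.+2) G m j.
  rewrite big_nat_recr //= [X in _ + X]big_geq // addr0 -sumrN.
  apply: eq_bigr => m _; rewrite -sumrN; apply: eq_big_nat => j; exact: Fgt.
have : \sum_(0 <= m < n.+2) ((\sum_(0 <= l < m) F m l) + (R m - R m.+1) +
    \sum_(m.+1 <= j < n.+2) F m j.+1) = 0.
  by rewrite big_nat big1 // => m mn; rewrite split_row.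
rewrite !big_split /= low high.
have -> : \sum_(0 <= m < n.+2) R m + \sum_(0 <= m < n.+2) - R m.+1 = R 0 - R n.+2.
  rewrite -big_split /=; under eq_bigr do rewrite -opprB.
  by rewrite sumrN telescope_sumr // opprB.
move=> /eqP; rewrite addrAC addr_eq0 => /eqP RE.
apply: (@oppr_inj _); rewrite -RE -opprD; congr (- _); rewrite -big_split.
apply: eq_big_nat => m mn /=; rewrite (big_cat_nat (n := m.+1)) //=.
by rewrite ltnW // ltnS (andP mn).2.
Qed.

Section Prism.
Variables (I : Type) (n : nat).

(** The [m]-th simplex of the triangulation of the prism over the simplex [i]:
    its vertices are [i 0], ..., [i m] at the bottom and [i m], ..., [i q] at
    the top. *)
Definition prism q (m : nat) (i : 'I_q.+1 -> I) (l : 'I_q.+2) : bool * I :=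
  ((m < l)%N, i (inord (unbump m l))).

(** The simplex between the [m]-th and the preceding one; it interpolates
    between the top ([m = 0]) and the bottom ([m = q]). *)
Definition prism_cut q (m : nat) (i : 'I_q -> I) (l : 'I_q) : bool * I :=
  ((m <= l)%N, i l).

Lemma prism_face_lt (i : 'I_n.+2 -> I) m j : (j <= m <= n)%N ->
  prism m.+1 i \o lift (inord j : 'I_n.+3) =
  prism m (i \o lift (inord j : 'I_n.+2)).
Proof.
move=> /andP[jm mn]; apply/funext => -[l /= ln].
rewrite /prism /= /bump inordK; last lia.
congr (_, i _); first lia.
by apply: val_inj; rewrite /= /unbump /bump !inordK; lia.
Qed.

Lemma prism_face_gt (i : 'I_n.+2 -> I) m j : (m < j < n.+2)%N ->
  prism m i \o lift (inord j.+1 : 'I_n.+3) =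
  prism m (i \o lift (inord j : 'I_n.+2)).
Proof.
move=> /andP[mj jn]; apply/funext => -[l /= ln].
rewrite /prism /= /bump inordK; last lia.
congr (_, i _); first lia.
by apply: val_inj; rewrite /= /unbump /bump !inordK; lia.
Qed.

Lemma prism_face_eq (i : 'I_n.+2 -> I) m : (m < n.+2)%N ->
  prism m i \o lift (inord m : 'I_n.+3) = prism_cut m i.
Proof.
move=> mn; apply/funext => -[l /= ln].
rewrite /prism /prism_cut /= /bump inordK; last lia.
congr (_, i _); first lia.
by apply: val_inj; rewrite /= /unbump !inordK; lia.
Qed.

Lemma prism_face_eqS (i : 'I_n.+2 -> I) m : (m < n.+2)%N ->
  prism m i \o lift (inord m.+1 : 'I_n.+3) = prism_cut m.+1 i.
Proof.
move=> mn; apply/funext => -[l /= ln].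
rewrite /prism /prism_cut /= /bump inordK; last lia.
congr (_, i _); first lia.
by apply: val_inj; rewrite /= /unbump !inordK; lia.
Qed.

Lemma prism_boundary (C : numFieldType) (tau : ('I_n.+2 -> bool * I) -> C)
    (i : 'I_n.+2 -> I) :
  (forall m, (m < n.+2)%N ->
     \sum_(l < n.+3) (-1) ^+ l * tau (prism m i \o lift l) = 0) ->
  \sum_(j < n.+2) (-1) ^+ j *
    (\sum_(m < n.+1) (-1) ^+ m * tau (prism m (i \o lift j))) =
  tau (fun l => (true, i l)) - tau (fun l => (false, i l)).
Proof.
move=> tau0.
pose F m l := (-1) ^+ (m + l) * tau (prism m i \o lift (inord l : 'I_n.+3)).
pose G m j := (-1) ^+ (m + j) * tau (prism m (i \o lift (inord j : 'I_n.+2))).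
pose R m := tau (prism_cut m i).
transitivity (\sum_(0 <= m < n.+1) \sum_(0 <= j < n.+2) G m j).
  rewrite [RHS]exchange_big /= [RHS]big_mkord; apply: eq_bigr => j _.
  rewrite big_mkord mulr_sumr; apply: eq_bigr => m _.
  by rewrite /G inord_val mulrA -exprD addnC.
rewrite (prism_sum (F := F) (R := R)).
- congr (tau _ - tau _); apply/funext => l; rewrite /prism_cut //.
  by congr (_, _); have := ltn_ord l; lia.
- by move=> m j jmn; rewrite /F /G prism_face_lt // addSn exprS mulN1r mulNr.
- by move=> m j mjn; rewrite /F /G prism_face_gt // addnS exprS mulN1r mulNr.
- move=> m mn; rewrite /F /R prism_face_eq // addnn -signr_odd odd_double.
  by rewrite expr0 mul1r.
- move=> m mn; rewrite /F /R prism_face_eqS // addnS addnn exprS -signr_odd.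
  by rewrite odd_double expr0 mulr1 mulN1r.
- move=> m mn; have /(congr1 ( *%R ((-1) ^+ m))) := tau0 m mn.
  rewrite mulr0 mulr_sumr => H; apply: etrans H; rewrite big_mkord.
  by apply: eq_bigr => l _; rewrite /F inord_val exprD mulrA.
Qed.

End Prism.

(** * The T cocycle *)

Section Forms.
Variables (C : numFieldType) (n : nat) (X : complexManifold C n) (k : nat).

Lemma Omega0 (W : set X) : open W -> Omega X k W 0.
Proof.
move=> oW; split=> [x c _|x c _ _|x c c' A _ _ _|c A] //.
  by split=> [A B D i0 b d _ _ _|A i1 i2 _ _]; rewrite -!/(0 : C) ?mulr0 ?addr0.
exact: holomorphic_cst.
Qed.

Lemma OmegaB (W : set X) (f g : X -> kcovector X k) : open W ->
  Omega X k W f -> Omega X k W g -> Omega X k W (f - g).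
Proof.
move=> oW [f0 fm fc fh] [g0 gm gc gh].
have fgE x c A : (f - g) x c A = f x c A - g x c A by [].
split=> [x c nWc|x c Wx cx|x c c' A Wx cx c'x|c A].
- by apply/funext => A; rewrite fgE f0 // g0 // subr0.
- have [fml fal] := fm x c Wx cx; have [gml gal] := gm x c Wx cx.
  split=> [A B D i0 b d rA rB rD|A i1 i2 ni rA]; rewrite !fgE.
    by rewrite (fml A B D i0 b d) // (gml A B D i0 b d) // !mulrBr opprD addrACA.
  by rewrite (fal A i1 i2) // (gal A i1 i2) // subr0.
- by rewrite !fgE (fc x c c') // (gc x c c').
- have oZ := chart_image_open (c := c) oW.
  have NE z : (f - g) (cinv c z) c A =
      f (cinv c z) c A + (-1) * g (cinv c z) c A by rewrite fgE mulN1r.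
  under eq_fun do rewrite NE.
  apply: holomorphicD => //; apply: holomorphicM => //.
  exact: holomorphic_cst.
Qed.

Lemma kcovector_eq_opp (v : kcovector X k) : v = - v -> v = 0.
Proof.
move=> vN; apply/funext => c; apply/funext => A.
have : v c A = - v c A by rewrite {1}vN.
by move/eqP; rewrite -addr_eq0 -mulr2n mulrn_eq0 => /eqP.
Qed.

Lemma form_signE (f : X -> kcovector X k) (b : bool) x c A :
  (f *~ (-1) ^+ b) x c A = (-1) ^+ b * f x c A.
Proof. by rewrite mulz_signV; case: b; rewrite ?expr1 ?mulN1r ?expr0 ?mul1r. Qed.

Lemma form_signed_sumE N (f : 'I_N -> X -> kcovector X k) x c A :
  (\sum_(j < N) f j *~ (-1) ^+ j) x c A = \sum_(j < N) (-1) ^+ j * f j x c A.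
Proof.
rewrite (big_morph (fun w : X -> kcovector X k => w x c A)
  (id1 := 0) (op1 := +%R)) //.
apply: eq_bigr => j _; rewrite -[(-1) ^+ j in LHS]signr_odd form_signE.
by rewrite signr_odd.
Qed.

End Forms.

Section TCocycle.
Variables (C : numFieldType) (n : nat) (X : complexManifold C n) (M : nat).
Implicit Types (U : open_cover X).

Lemma gl_cocycle_sub (J : Type) (W W' : set X) (g : J -> J -> X -> 'M[C]_M) :
  W' `<=` W -> gl_cocycle W g -> gl_cocycle W' g.
Proof.
move=> W'W [gW g1 gM]; split=> [a b p q|x a /W'W|x a b d /W'W]; last 2 first.
- exact: g1.
- exact: gM.
exact: holo_fun_sub (gW a b p q).
Qed.

(** [J] indexes frames, [r j] the open set on which the frame [j] lives: an open
    set may carry several frames. *)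
Definition gl_system U (J : Type) (r : J -> cover_idx U)
    (g : J -> J -> X -> 'M[C]_M) : Prop :=
  forall q (i : 'I_q -> J), gl_cocycle (cap (r \o i)) (fun a b => g (i a) (i b)).

Lemma T_cochain_alternating U (g : cover_idx U -> cover_idx U -> X -> 'M[C]_M) k :
  alternating (fun i : 'I_k.+1 -> cover_idx U => restr (cap i) (T_form g i)).
Proof. by move=> i s; rewrite T_form_perm cap_perm restr_sign. Qed.

Lemma T_cocycleE U (g : cover_idx U -> cover_idx U -> X -> 'M[C]_M) k :
  T_cocycle g k = fun i => restr (cap i) (T_form g i).
Proof.
apply: alt_ext_id; first exact: kcovector_eq_opp.
exact: T_cochain_alternating.
Qed.

Lemma T_cocycle_cocycle U (g : cover_idx U -> cover_idx U -> X -> 'M[C]_M) k :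
  (0 < k)%N -> gl_system id g -> cocycle (Omega X k) (T_cocycle g k).
Proof.
move=> k_gt0 gP; rewrite T_cocycleE; split.
  apply: cochainP => [|i|]; first exact: kcovector_eq_opp.
    exact: (T_form_Omega (cap_open i) (gP _ i) id).
  exact: T_cochain_alternating.
apply/funext => i; apply/funext => x; apply/funext => c; apply/funext => A.
have [capx|capx] := pselect (cap i x); last by rewrite /cech_diff restr_out.
rewrite /cech_diff restrE // form_signed_sumE.
rewrite -[RHS](T_form_cocycle (cap_open i) (gP _ i) id c A k_gt0 capx).
by apply: eq_bigr => j _; rewrite restrE // => a; exact: capx.
Qed.

(** Each open set of the cover carries two frames, told apart by a boolean. The
    primitive is the prism operator applied to the T forms of the doubled
    system. These are alternating, but their image under the prism operator is
    not: it is kept at increasing tuples and extended alternatingly, which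
    does not affect its coboundary at increasing tuples. *)
Lemma T_cocycle_homotopic U k
    (h : bool * cover_idx U -> bool * cover_idx U -> X -> 'M[C]_M) :
  (0 < k)%N -> gl_system snd h ->
  coboundary (Omega X k) (T_cocycle (fun i j => h (true, i) (true, j)) k -
                          T_cocycle (fun i j => h (false, i) (false, j)) k).
Proof.
case: k => // k _ hP.
pose b0 : raw_cochain (kcovector X k.+1) U k := fun i =>
  \sum_(m < k.+1) restr (cap i) (T_form h (prism m i)) *~ (-1) ^+ m.
have S0 := @Omega0 _ _ X k.+1; have SB := @OmegaB _ _ X k.+1.
have V2 := @kcovector_eq_opp _ _ X k.+1.
exists (alt_ext b0).
  apply: alt_ext_cochain => // i; apply: (section_sum S0 SB) => [|m].
    exact: cap_open.
  rewrite -signr_odd; apply: (section_sign S0 SB); first exact: cap_open.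
  apply: (T_form_Omega (g := fun a b => h (prism m i a) (prism m i b))
    (cap_open i) _ id) => //.
  by apply: gl_cocycle_sub (hP _ (prism m i)) => x capx a; exact: capx.
apply: (eq_alternating V2).
- by apply: alternatingB; exact: alt_ext_alternating.
- exact/cech_diff_alternating/alt_ext_alternating.
move=> i inc; rewrite !T_cocycleE.
apply/funext => x; apply/funext => c; apply/funext => A.
pose T e := restr (cap i) (T_form (fun i j => h (e, i) (e, j)) i).
apply: (@etrans _ _ (T true x c A - T false x c A)); first by [].
have [capx|capx] := pselect (cap i x); last first.
  have T0 e : T e x c A = 0 by rewrite /T restr_out.
  by rewrite !T0 subr0 /cech_diff restr_out.
have TE e : T e x c A = T_form (fun i j => h (e, i) (e, j)) i x c A.
  by rewrite /T restrE.
rewrite !TE /cech_diff restrE // form_signed_sumE.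
rewrite -(prism_boundary (tau := fun p => T_form h p x c A)); last first.
  move=> m mk; apply: (T_form_cocycle (cap_open i) (x := x)
    (g := fun a b => h (prism m i a) (prism m i b)) _ id) => //.
  by apply: gl_cocycle_sub (hP _ (prism m i)) => y capy a; exact: capy.
apply: eq_bigr => j _; congr (_ * _).
rewrite alt_ext_increasing; last first.
  apply/increasingP => a b ab /=; have /increasingP := inc; apply.
  by rewrite /= /bump; lia.
rewrite /b0 form_signed_sumE; apply: eq_bigr => m _.
by rewrite restrE // => a; exact: capx.
Qed.

End TCocycle.

(** * Trivializations and their transition functions *)

Section Transitions.
Variables (C : numFieldType) (n : nat) (X : complexManifold C n) (M : nat).
Variable E : holVectorBundle X M.
Implicit Types (W : set X) (psi : frame M (fibre E)).

Lemma frame_compat_sub W W' psi psi' :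
  W' `<=` W -> frame_compat W psi psi' -> frame_compat W' psi psi'.
Proof.
move=> W'W [g [h [gW hW tg th]]]; exists g, h; split.
- by move=> a b; exact: holo_fun_sub (gW a b).
- by move=> a b; exact: holo_fun_sub (hW a b).
- by move=> x /W'W Wx; exact: tg.
- by move=> x /W'W Wx; exact: th.
Qed.

Lemma frame_mulmx_inj W psi x (A B : 'M[C]_M) : is_frame W psi -> W x ->
  (forall e, A *m psi x e = B *m psi x e) -> A = B.
Proof.
move=> fr Wx AB; have [_ [f fK Kf]] := fr x Wx.
apply/matrixP => a b; have := AB (f (delta_mx b 0)); rewrite Kf -!colE.
by move/colP/(_ a); rewrite !mxE.
Qed.

(** Compare both frames with a local frame of the bundle. *)
Lemma transition_exists W psi psi' :
  (forall a, frame_compat (W `&` bdom a) psi (bframe a)) ->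
  (forall a, frame_compat (W `&` bdom a) psi' (bframe a)) ->
  exists g, is_transition W psi psi' g.
Proof.
move=> cpsi cpsi'; have [x|g gP] := @choice X 'M[C]_M (fun x A =>
  W x -> forall e, psi x e = A *m psi' x e); last by exists g.
have [Wx|Wx] := pselect (W x); last by exists 0.
have [a ax] := bdom_cover E x.
have [g [_ [_ _ tg _]]] := cpsi a; have [_ [h [_ _ _ th]]] := cpsi' a.
by exists (g x *m h x) => _ e; rewrite (tg x) // (th x) // mulmxA.
Qed.

(** Transition matrices are determined by the frames, which gives the cocycle
    identities; holomorphy is local and holds by comparison with the local
    frames of the bundle. *)
Lemma transition_gl_cocycle (J : Type) W (psi : J -> frame M (fibre E))
    (g : J -> J -> X -> 'M[C]_M) : open W ->
  (forall j, is_frame W (psi j)) ->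
  (forall j a, frame_compat (W `&` bdom a) (psi j) (bframe a)) ->
  (forall i j, is_transition W (psi i) (psi j) (g i j)) ->
  gl_cocycle W g.
Proof.
move=> oW fr cpsi tg; split=> [i j p q|x i Wx|x i j l Wx]; last 2 first.
- by apply: (frame_mulmx_inj (fr i) Wx) => e; rewrite mul1mx -tg.
- apply: (frame_mulmx_inj (fr l) Wx) => e.
  by rewrite -mulmxA -(tg j l) // -(tg i j) // -(tg i l).
apply: holo_fun_local => x Wx; have [a ax] := bdom_cover E x.
exists (W `&` bdom a) => //.
have [u [_ [uW _ tu _]]] := cpsi i a; have [_ [v [_ vW _ tv]]] := cpsi j a.
have oWa : open (W `&` bdom a) by apply: openI => //; exact: bdom_open.
apply: eq_holo_fun oWa _ (holo_mulmx oWa uW vW p q) => y [Wy ay].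
congr (fun_of_matrix _ p q); apply: (frame_mulmx_inj (fr j) Wy) => e.
by rewrite -mulmxA -(tv y) // -(tu y) // -(tg i j).
Qed.

Lemma transition_gl_system (U : open_cover X) (J : Type) (r : J -> cover_idx U)
    (psi : J -> frame M (fibre E)) (g : J -> J -> X -> 'M[C]_M) :
  (forall j, is_frame (U (r j)) (psi j)) ->
  (forall j a, frame_compat (U (r j) `&` bdom a) (psi j) (bframe a)) ->
  (forall i j, is_transition (U (r i) `&` U (r j)) (psi i) (psi j) (g i j)) ->
  gl_system r g.
Proof.
move=> fr cpsi tg q i; have capU a : cap (r \o i) `<=` U (r (i a)).
  by move=> x; exact.
apply: (transition_gl_cocycle (psi := psi \o i)); first exact: cap_open.
- by move=> j x /capU Wx; exact: fr.
- by move=> j a; apply: frame_compat_sub (cpsi (i j) a); exact: setSI.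
- by move=> a b x capx; apply: tg; split; exact: capU.
Qed.

Lemma trivialization_gl_system (U : open_cover X) (phi : trivialization E U) g :
  transition_system phi g -> gl_system id g.
Proof.
move=> tg; apply: (transition_gl_system (psi := phi)) => //.
  by move=> j x; exact: tframeP.
exact: tframe_holo.
Qed.

(** The frames of both trivializations form a single system over the doubled
    index set; its mixed transition functions are chosen arbitrarily. *)
Lemma T_cocycle_cohomologous (U : open_cover X) (phi phi' : trivialization E U)
    g g' k : (0 < k)%N -> transition_system phi g -> transition_system phi' g' ->
  coboundary (Omega X k) (T_cocycle g' k - T_cocycle g k).
Proof.
move=> k_gt0 tg tg'.
pose psi (p : bool * cover_idx U) := if p.1 then phi' p.2 else phi p.2.
have fr p : is_frame (U p.2) (psi p).
  by rewrite /psi; case: p => [[] i] x /=; exact: tframeP.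
have cpsi p a : frame_compat (U p.2 `&` bdom a) (psi p) (bframe a).
  by rewrite /psi; case: p => [[] i] /=; exact: tframe_holo.
have /choice[u uP] : forall pp' : (bool * cover_idx U) * (bool * cover_idx U),
    exists f, is_transition (U pp'.1.2 `&` U pp'.2.2) (psi pp'.1) (psi pp'.2) f.
  move=> [p p'] /=; apply: transition_exists => a.
    by apply: frame_compat_sub (cpsi p a) => x [[]].
  by apply: frame_compat_sub (cpsi p' a) => x [[]].
pose h p p' := match p.1, p'.1 with
  | true, true => g' p.2 p'.2
  | false, false => g p.2 p'.2
  | _, _ => u (p, p')
  end.
apply: (@T_cocycle_homotopic _ _ _ _ _ k h k_gt0).
apply: (transition_gl_system (psi := psi)) => // -[[] i] [[] j].
- exact: tg'.
- exact: (uP ((true, i), (false, j))).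
- exact: (uP ((false, i), (true, j))).
- exact: tg.
Qed.

Section Pullback.
Variables (U W : open_cover X) (r : cover_idx W -> cover_idx U).
Hypothesis rP : refinement r.

Lemma pullback_frame (phi : trivialization E U) j : is_frame (W j) (phi (r j)).
Proof. by move=> x /rP; exact: tframeP. Qed.

Lemma pullback_holo (phi : trivialization E U) j a :
  frame_compat (W j `&` bdom a) (phi (r j)) (bframe a).
Proof. by apply: frame_compat_sub (tframe_holo phi (r j) a); apply: setSI; exact: rP. Qed.

Definition pullback (phi : trivialization E U) : trivialization E W :=
  Trivialization (pullback_frame phi) (pullback_holo phi).

Lemma pullback_transition (phi : trivialization E U) g :
  transition_system phi g ->
  transition_system (pullback phi) (fun i j => g (r i) (r j)).
Proof. by move=> tg i j x [/rP Ux /rP Ux'] e; apply: tg; split. Qed.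

Lemma refine_T_cocycle (g : cover_idx U -> cover_idx U -> X -> 'M[C]_M) k :
  refine r (T_cocycle g k) = T_cocycle (fun i j => g (r i) (r j)) k.
Proof.
rewrite !T_cocycleE; apply/funext => j; apply/funext => x.
rewrite /refine; have [capx|capx] := pselect (cap j x); last by rewrite !restr_out.
by rewrite !restrE // => a; apply/rP/capx.
Qed.

End Pullback.

Lemma T_class_refine (U W : open_cover X) (r : cover_idx W -> cover_idx U)
    (g : cover_idx U -> cover_idx U -> X -> 'M[C]_M) k
    (ht : cocycle (Omega X k) (T_cocycle g k))
    (ht' : cocycle (Omega X k) (T_cocycle (fun i j => g (r i) (r j)) k)) :
  refinement r ->
  refine_to (existT _ U (cech_class ht)) (existT _ W (cech_class ht')).
Proof.
move=> rP; exists r, (T_cocycle g k); split=> //=.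
by rewrite refine_T_cocycle.
Qed.

End Transitions.

(** * Passage to the direct limit *)

Section CommonRefinement.
Variables (T : topologicalType) (U U' : open_cover T).

Lemma meet_cover_open (p : (cover_idx U *l cover_idx U')%type) :
  open (U p.1 `&` U' p.2).
Proof. by apply: openI; exact: cover_open. Qed.

Lemma meet_cover_full x :
  exists p : (cover_idx U *l cover_idx U')%type, (U p.1 `&` U' p.2) x.
Proof.
have [i Ux] := cover_full U x; have [j U'x] := cover_full U' x.
by exists (i, j).
Qed.

(** Classes are pulled back along maps of indices that need not be monotone, so
    that any total order on the pairs will do. *)
Definition meet_cover : open_cover T := OpenCover meet_cover_open meet_cover_full.

Lemma meet_cover_refinel :
  refinement (fst : cover_idx meet_cover -> cover_idx U).
Proof. by move=> p x []. Qed.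

Lemma meet_cover_refiner :
  refinement (snd : cover_idx meet_cover -> cover_idx U').
Proof. by move=> p x []. Qed.

End CommonRefinement.

Lemma cech_class_eq (T : topologicalType) (V : zmodType)
    (S : set T -> set (T -> V)) (U : open_cover T) q (t t' : raw_cochain V U q)
    (ht : cocycle S t) (ht' : cocycle S t') :
  coset S t = coset S t' -> cech_class ht = cech_class ht'.
Proof. exact: eq_exist. Qed.

Lemma to_lim_eq (T : topologicalType) (V : zmodType)
    (S : set T -> set (T -> V)) q (U U' : open_cover T)
    (a : cechH S U q) (a' : cechH S U' q) :
  clos_refl_sym_trans _ (@refine_to _ _ S q) (existT _ U a) (existT _ U' a') ->
  to_lim a = to_lim a'.
Proof.
move=> aa'; apply: eq_exist; apply/funext => b; apply/propext.
by split=> H; [apply: rst_trans H; apply: rst_sym | apply: rst_trans H].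
Qed.

Section Class.
Variables (C : numFieldType) (n : nat) (X : complexManifold C n) (M : nat).
Variables (E : holVectorBundle X M) (k : nat).
Hypothesis k_gt0 : (0 < k)%N.

Lemma T_cocycleP (U : open_cover X) (phi : trivialization E U) g :
  transition_system phi g -> cocycle (Omega X k) (T_cocycle g k).
Proof. by move=> /trivialization_gl_system; exact: T_cocycle_cocycle. Qed.

Lemma T_class_unique (U : open_cover X) (phi phi' : trivialization E U) g g'
    (tg : transition_system phi g) (tg' : transition_system phi' g') :
  cech_class (T_cocycleP tg) = cech_class (T_cocycleP tg').
Proof.
apply: cech_class_eq; apply: eq_coset.
- exact: kcovector_eq_opp.
- exact: OmegaB.
exact: T_cocycle_cohomologous tg' tg.
Qed.

Lemma T_lim_unique (U U' : open_cover X) (phi : trivialization E U)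
    (phi' : trivialization E U') g g'
    (tg : transition_system phi g) (tg' : transition_system phi' g') :
  to_lim (cech_class (T_cocycleP tg)) = to_lim (cech_class (T_cocycleP tg')).
Proof.
have tl := pullback_transition (@meet_cover_refinel _ U U') tg.
have tr := pullback_transition (@meet_cover_refiner _ U U') tg'.
pose W := meet_cover U U'.
pose cl := cech_class (T_cocycleP tl); pose cr := cech_class (T_cocycleP tr).
have rl : refine_to (existT _ U (cech_class (T_cocycleP tg))) (existT _ W cl).
  exact: T_class_refine (@meet_cover_refinel _ U U').
have rr : refine_to (existT _ U' (cech_class (T_cocycleP tg'))) (existT _ W cr).
  exact: T_class_refine (@meet_cover_refiner _ U U').
have eq_c : cl = cr := T_class_unique tl tr.
move: cl cr eq_c rl rr => cl _ <- rl rr; apply: to_lim_eq.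
apply: (rst_trans _ _ _ (existT _ W cl)); first exact: rst_step.
by apply: rst_sym; exact: rst_step.
Qed.

Definition zero_class (U : open_cover X) : cechH (Omega X k) U k :=
  cech_class (cocycle0 (@kcovector_eq_opp _ _ X k) (@Omega0 _ _ X k) U k).

Definition whole_cover : open_cover X :=
  @OpenCover X _ (bool : orderType _) (fun=> setT) (fun=> openT) (fun x => ex_intro _ true I).

End Class.

(** * The T invariant *)

Theorem theorem1p2 (R : realType) (n : nat) (X : complexManifold R[i]%C n)
    (M : nat) (E : holVectorBundle X M) (k : nat) (k_gt0 : (0 < k)%N) :
  exists (fU : forall U : open_cover X, cechH (Omega X k) U k)
         (f : cech_lim (Omega X k) k),
    forall (U : open_cover X) (phi : trivialization E U)
           (g : cover_idx U -> cover_idx U -> X -> 'M[R[i]%C]_M),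
      transition_system phi g ->
      exists ht : cocycle (Omega X k) (T_cocycle g k),
        cech_class ht = fU U /\ to_lim (fU U) = f.
Proof.
(* Covers without a trivialization of [E] receive the class 0; if there is no
   other cover, [f] is arbitrary. *)
pose has_system U (a : cechH (Omega X k) U k) := exists (phi : trivialization E U)
  g (tg : transition_system phi g), a = cech_class (T_cocycleP k_gt0 tg).
have /all_tag[fU fUP] U : {a : cechH (Omega X k) U k |
    (exists (phi : trivialization E U) g, transition_system phi g) ->
    has_system U a}.
  have [ex|nex] := pselect (exists (phi : trivialization E U) g,
    transition_system phi g); last by exists (zero_class k U).
  apply: cid; have [phi [g tg]] := ex.
  by exists (cech_class (T_cocycleP k_gt0 tg)) => _; exists phi, g, tg.
exists fU.
have [[U0 [phi0 [g0 tg0]]]|nex] := pselect (exists U (phi : trivialization E U) g,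
    transition_system phi g); last first.
  exists (to_lim (fU (whole_cover X))) => U phi g tg; case: nex.
  by exists U, phi, g.
exists (to_lim (cech_class (T_cocycleP k_gt0 tg0))) => U phi g tg.
exists (T_cocycleP k_gt0 tg).
have [|phi1 [g1 [tg1 fUE]]] := fUP U; first by exists phi, g.
rewrite fUE; split; first exact: T_class_unique.
exact: T_lim_unique.
Qed.
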